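(* Let $X=W/\langle f\rangle$ be a (diagonal) Hopf manifold of dimension $n\ge 2$, let $\pi:W\to X$ be the natural projection, and let $\mathcal{F}$ be a singular holomorphic Pfaff system on $X$ of codimension $k$, given by a nonzero twisted differential $k$-form $\omega\in H^0(X,\Omega_X^k\otimes L_b)$ with coefficients in the line bundle $L_b$, $b\in\mathbb{C}^*$. Then the following holds. (i) If $X$ is classical (with $\mu=\mu_1=\dots=\mu_n$), then $b=\mu^m$ with $m\in\mathbb{N}$ and $m\ge k$. Furthermore, $\pi^*\omega$ is a homogeneous polynomial $k$-form of degree $m-k$ (i.e. its coefficients with respect to the forms $dz_{i_1}\wedge\dots\wedge dz_{i_k}$ are homogeneous polynomials of degree $m-k$). (ii) If $X$ is no-resonance, then $b=\mu_1^{m_1}\cdots\mu_n^{m_n}$ with $m_j\in\{0,1\}$ for all $j=1,\dots,n$. Furthermore, $\pi^*\omega$ is a monomial $k$-form of the type $$\sum_{i_1<\dots<i_k} g_{i_1\dots i_k}\,dz_{i_1}\wedge\dots\wedge dz_{i_k},$$ with $$g_{i_1\dots i_k}(z_1,\dots,z_n)=c_m^{i_1\dots i_k}\, z_{j_1}^{m_{j_1}}z_{j_2}^{m_{j_2}}\cdots z_{j_{n-k}}^{m_{j_{n-k}}},$$ where $c_m^{i_1\dots i_k}\in\mathbb{C}$ and $\{j_1,\dots,j_{n-k}\}=\{1,\dots,n\}\setminus\{i_1,\dots,i_k\}$. (iii) If $X$ is weak no-resonance (with $\mu=\mu_1=\dots=\mu_r$), then $b=\mu^m\mu_{r+1}^{m_{r+1}}\cdots\mu_n^{m_n}$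 with $m\in\mathbb{N}$ and $m_j\in\{0,1\}$ for all $j=r+1,\dots,n$. Furthermore, $\pi^*\omega$ is a polynomial $k$-form of the type $$\pi^*\omega=\sum_{i_1<\dots<i_k} g_{i_1\dots i_k}\,dz_{i_1}\wedge\dots\wedge dz_{i_k},$$ where $$g_{i_1\dots i_k}=z_{j_1}^{m_{j_1}}\cdots z_{j_{n-r-k+s}}^{m_{j_{n-r-k+s}}}\cdot\sum_{\alpha_1+\dots+\alpha_r=m-s} c_\alpha^{i_1\dots i_k}\, z_1^{\alpha_1}\cdots z_r^{\alpha_r},$$ with $c_\alpha^{i_1\dots i_k}\in\mathbb{C}$, where, for each $i_1<\dots<i_k$, the number $s\in\{0,\dots,k\}$ is defined in such a way that $i_1,\dots,i_s\le r$ and $r+1\le i_{s+1},\dots,i_k$, and $\{j_1,\dots,j_{n-r-k+s}\}=\{r+1,\dots,n\}\setminus\{i_{s+1},\dots,i_k\}$.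
   Context: $\mathbb{N}$ includes $0$. Let $n\ge 2$, $W=\mathbb{C}^n\setminus\{0\}$ with coordinates $z_1,\dots,z_n$, and $f(z_1,\dots,z_n)=(\mu_1z_1,\dots,\mu_nz_n)$ with $0<|\mu_i|<1$ for all $i$. The compact complex manifold $X=W/\langle f\rangle$ is called a (diagonal) Hopf manifold. Types of Hopf manifolds: - $X$ is classical if $\mu_1=\dots=\mu_n=:\mu$. - $X$ is no-resonance if $0<|\mu_1|\le|\mu_2|\le\dots\le|\mu_n|<1$ and there is no non-trivial relation (i.e. none with exponents not all zero) of the form $\prod_{i\in A}\mu_i^{r_i}=\prod_{j\in B}\mu_j^{r_j}$ with $r_i,r_j\in\mathbb{N}$, $A\cap B=\emptyset$, $A\cup B=\{1,\dots,n\}$. - $X$ is weak no-resonance if $\mu_1=\dots=\mu_r=:\mu$ for some $r$ with $2\le r\le n-1$ and there is no non-trivial relation of the form $\prod_{i\in A}\mu_i^{r_i}=\prod_{j\in B}\mu_j^{r_j}$ with $r_i,r_j\in\mathbb{N}$, $A\cap B=\emptyset$, $A\cup B=\{1,r+1,\dots,n\}$. For $b\in\mathbb{C}^*$, $L_b$ denotes the line bundle on $X$ obtained as the quotient of $W\times\mathbb{C}$ by the $\mathbb{Z}$-action generated by $(z,v)\mapsto(f(z),bv)$. Its pullback to $W$ is canonically trivial, so for $\omega\in H^0(X,\Omega_X^k\otimes L_b)$ the pullback $\pi^*\omega$ is regarded as a holomorphic $k$-form on $W$; it satisfies $f^*(\pi^*\omega)=b\,\pi^*\omega$. A holomorphic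 singular Pfaff system of codimension $k$ ($k\geq 1$) on a complex manifold $X$ is a non-trivial section $\omega\in H^0(X,\Omega_X^k\otimes\mathcal{L})$, with $\mathcal{L}$ a holomorphic line bundle, whose singular set $\mathrm{Sing}(\omega)=\{z\in X:\omega(z)=0\}$ has codimension at least $2$ (this is part of the definition). It is not assumed to be locally decomposable. The constants $c$ in the claim may be zero, and an empty sum is $0$. *)

(* Defs.v *)
From HB Require Import structures.
From mathcomp Require Import all_boot all_order all_algebra.
From mathcomp Require Import complex.
From mathcomp Require Import boolp classical_sets reals topology normedtype derive.

Set Implicit Arguments.
Unset Strict Implicit.
Unset Printing Implicit Defensive.

Import Order.TTheory GRing.Theory Num.Theory.
Import numFieldNormedType.Exports.
Local Open Scope classical_set_scope.
Local Open Scope ring_scope.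

(* R[i] packaged as a numClosedFieldType, so that it carries the normed-module
   structure over itself; [differentiable] over it is complex (Frechet)
   differentiability, i.e. holomorphy when required on an open set. *)
Definition Cplx (R : realType) : numClosedFieldType := R[i].

(* For a bijection F, the orbit of x under the Z-action generated by F. *)
Definition zorbit (T : Type) (F : T -> T) (x : T) : set T :=
  [set y | exists m : nat, iter m F x = y \/ iter m F y = x].

(* The quotient S / <F>, for F a bijection of T with F(S) = S. *)
Definition orbit_space (T : Type) (S : set T) (F : T -> T) : Type :=
  {A : set T | exists2 x, S x & A = zorbit F x}.

Definition orb (T : Type) (S : set T) (F : T -> T) (x : T) (Sx : S x) :
    orbit_space S F :=
  exist _ (zorbit F x) (ex_intro2 _ _ x Sx erefl).

Section ComplexSpace.
Variables (R : realType) (n : nat).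
Local Notation C := (Cplx R).

(* A frame V : 'M_(k, n) is a k-tuple of tangent vectors, given by its rows. *)
Definition tangent_map (k : nat) (f : 'rV[C]_n -> 'rV[C]_n) (z : 'rV[C]_n)
    (V : 'M[C]_(k, n)) : 'M[C]_(k, n) :=
  \matrix_(a < k) ('d f z (row a V) : 'rV[C]_n).

Definition alternating_multilinear (k : nat) (eta : 'M[C]_(k, n) -> C) : Prop :=
  (forall (V V1 V2 : 'M[C]_(k, n)) (a : 'I_k) (c1 c2 : C),
     row a V = c1 *: row a V1 + c2 *: row a V2 ->
     row' a V1 = row' a V -> row' a V2 = row' a V ->
     eta V = c1 * eta V1 + c2 * eta V2) /\
  (forall (V : 'M[C]_(k, n)) (a1 a2 : 'I_k),
     a1 != a2 -> row a1 V = row a2 V -> eta V = 0).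

(* Holomorphic k-forms on W = C^n \ {0}; the value at 0 is irrelevant. *)
Definition holomorphic_form (k : nat)
    (theta : 'rV[C]_n -> 'M[C]_(k, n) -> C) : Prop :=
  forall z : 'rV[C]_n, z != 0 ->
    alternating_multilinear (theta z) /\
    (forall V : 'M[C]_(k, n), differentiable (fun w => theta w V : C) z).

Definition increasing (k : nat) (i : {ffun 'I_k -> 'I_n}) : bool :=
  [forall a : 'I_k, forall c : 'I_k, (a < c)%N ==> (i a < i c)%N].

(* dz_{i_1} /\ ... /\ dz_{i_k} evaluated on the rows of V. *)
Definition wedge_dz (k : nat) (i : {ffun 'I_k -> 'I_n}) (V : 'M[C]_(k, n)) : C :=
  \det (colsub i V).

(* Near p, the set Z is a complex submanifold of codimension d. *)
Definition submanifold_at (Z : set 'rV[C]_n) (d : nat) (p : 'rV[C]_n) : Prop :=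
  exists (U : set 'rV[C]_n) (h : 'rV[C]_n -> 'rV[C]_d),
    [/\ open U, U p,
        forall z, U z -> differentiable h z /\ \rank ('J h z) = d
      & Z `&` U = [set z | U z /\ h z = 0]].

(* For an analytic subset Z of an open set, dim Z is the maximum of the
   dimensions of Z at its regular points. *)
Definition analytic_codim_ge (Z : set 'rV[C]_n) (c : nat) : Prop :=
  forall (p : 'rV[C]_n) (d : nat), Z p -> submanifold_at Z d p -> (c <= d)%N.

(* sum_{alpha_1 + ... + alpha_p = m - s} c_alpha x^alpha, the sum being empty
   when m < s; the bound alpha_l <= m only makes the index type finite. *)
Definition homogeneous_sum (p m s : nat) (c : {ffun 'I_p -> 'I_m.+1} -> C)
    (x : 'I_p -> C) : C :=
  \sum_(alpha : {ffun 'I_p -> 'I_m.+1} | (\sum_(l < p) alpha l + s == m)%N)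
    c alpha * \prod_(l < p) x l ^+ alpha l.

End ComplexSpace.

Section Hopf.
Variables (R : realType) (n : nat) (mu : 'I_n -> Cplx R).
Local Notation C := (Cplx R).

Definition hopf_map (z : 'rV[C]_n) : 'rV[C]_n := \row_j (mu j * z 0 j).

Definition hopf_manifold : Type :=
  orbit_space [set z : 'rV[C]_n | z != 0] hopf_map.

(* The k-fold fibre product over X of its tangent bundle: (W x (C^n)^k) / <(f, df)>. *)
Definition hopf_frames (k : nat) : Type :=
  orbit_space [set p : 'rV[C]_n * 'M[C]_(k, n) | p.1 != 0]
    (fun p => (hopf_map p.1, tangent_map hopf_map p.1 p.2)).

Definition hopf_line_bundle (b : C) : Type :=
  orbit_space [set p : 'rV[C]_n * C | p.1 != 0]
    (fun p => (hopf_map p.1, b * p.2)).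

Section TwistedForms.
Variables (b : C) (k : nat).
(* An L_b-valued k-form on X is a map TX^k -> L_b; [is_pullback] makes it
   fibre-preserving. *)
Variable omega : hopf_frames k -> hopf_line_bundle b.

(* theta is the pullback of omega to W, read in the canonical trivialization of
   the pullback of L_b; as the action on W is free, it is unique on W. *)
Definition is_pullback (theta : 'rV[C]_n -> 'M[C]_(k, n) -> C) : Prop :=
  forall (z : 'rV[C]_n) (hz : z != 0) (V : 'M[C]_(k, n)),
    omega (@orb _ [set p | p.1 != 0] _ (z, V) hz) =
    @orb _ [set p | p.1 != 0] _ (z, theta z V) hz.

(* omega is in H^0(X, Omega_X^k (x) L_b): the projection W -> X is a local
   biholomorphism, so holomorphy can be tested on the pullback. *)
Definition holomorphic_section : Prop :=
  exists2 theta, is_pullback theta & holomorphic_form theta.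

Definition Sing : set hopf_manifold :=
  [set x | forall (z : 'rV[C]_n) (hz : z != 0) (V : 'M[C]_(k, n)),
     x = @orb _ [set z | z != 0] _ z hz ->
     omega (@orb _ [set p | p.1 != 0] _ (z, V) hz) =
     @orb _ [set p | p.1 != 0] _ (z, 0) hz].

(* The codimension of Sing in X is computed in the charts given by the local
   inverses of W -> X, i.e. on the preimage of Sing in W. *)
Definition pfaff_system : Prop :=
  [/\ (1 <= k)%N, holomorphic_section, (exists x, ~ Sing x)
    & analytic_codim_ge
        [set z | exists hz : z != 0, Sing (@orb _ [set z | z != 0] _ z hz)] 2].

End TwistedForms.

Definition no_relation (S : {set 'I_n}) : Prop :=
  forall (A B : {set 'I_n}) (e : 'I_n -> nat),
    (A :&: B)%SET = finset.set0 -> (A :|: B)%SET = S ->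
    \prod_(i in A) mu i ^+ e i = \prod_(j in B) mu j ^+ e j ->
    forall i, i \in S -> e i = 0%N.

Definition classical (mu0 : C) : Prop := forall i, mu i = mu0.

Definition no_resonance : Prop :=
  (forall i j : 'I_n, (i <= j)%N -> `|mu i| <= `|mu j|) /\
  no_relation [set: 'I_n]%SET.

(* Indices are shifted by one: mu_1, ..., mu_r are the mu i with i < r, and
   r : 'I_n means r <= n - 1. *)
Definition weak_no_resonance (r : 'I_n) (mu0 : C) : Prop :=
  [/\ (2 <= r)%N, (forall i : 'I_n, (i < r)%N -> mu i = mu0)
    & no_relation [set i : 'I_n | (i == 0 :> nat) || (r <= i)%N]%SET].

End Hopf.

(* Main.v *)
(** Proof. On W the form theta is the sum of g_I dz_I with holomorphic g_I
satisfying g_I o f = lambda_I g_I, where lambda_I = b / mu_I. Pulling a point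
back to a fixed compact shell around 0 by iterates of f shows that g_I has
polynomial growth, so it is a polynomial in each variable separately (Liouville;
the other variables may vanish, as long as they do not all vanish), hence a
polynomial, and comparing coefficients in g_I o f = lambda_I g_I leaves only the
monomials z^alpha with mu^alpha mu_I = b. The (absence of) relations between the
mu_i then determines alpha + 1_I, partially or completely, from b. Finally, an
exponent of z_j in alpha + 1_I that is common to all monomials is at most 1:
otherwise z_j would divide all the g_I and Sing would contain a hypersurface.

Liouville's theorem is proved for continuous functions that are differentiable
off a finite set, a class stable under q |-> (q(w) - q(x)) / (w - x) which lowers
the growth by one degree; the base case q = O(1/|z|) is Cauchy's formula on
large squares, from Goursat's lemma. *)

Require Import Defs.
From mathcomp Require Import all_boot all_order all_algebra.
From mathcomp Require Import perm complex.
From mathcomp Require Import boolp classical_sets functions reals topology normedtype derive.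
From mathcomp Require Import ereal sequences realfun measure lebesgue_measure lebesgue_integral ftc.
From mathcomp Require Import zify ring lra.

Set Implicit Arguments.
Unset Strict Implicit.
Unset Printing Implicit Defensive.

Import Order.TTheory GRing.Theory Num.Theory.
Import numFieldNormedType.Exports.
Local Open Scope ring_scope.

(** * The modulus as a real number, and continuity expressed through it *)

Section Modulus.
Variable R : realType.
Local Notation C := (Cplx R).
Implicit Types (z w : C) (x y : R).

(** The degree bound is the same on all coordinate lines: it is a single N with rho^N <= |lambda_I|,
    where rho < 1 bounds all the |mu_j|. Indeed f shrinks a point by a factor rho at least and
    multiplies g_I by lambda_I. This uniformity makes interpolation possible: a function that is
    polynomial of degree < D on coordinate lines is recovered from its values on a grid of D^n
    points by an inverse Vandermonde matrix in each variable. The grid plays the part of a Taylor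
    expansion at 0, a point outside W, and it is chosen off 0. The obstacle is a coordinate axis,
    whose own line runs through 0; it is reached by moving a second coordinate, which takes n >= 2.

    The vector alpha + 1_I is the weight of z^alpha dz_I under f, as dz_j is scaled like one more
    factor z_j. This is why the bound 1, and not 0, is what divisibility by z_j yields: a weight 2
    leaves a factor z_j even where dz_j is present. *)

Definition cmod z : R := complex.Re `|z|.
Definition cpt x y : C := Complex x y.

(** The norm of [C] is complex-valued and its order is partial; this rewriting moves estimates to
    the reals, where the order is total. *)
Lemma normE_cmod z : `|z| = (cmod z)%:C%C.
Proof. by rewrite /cmod RRe_real // normr_real. Qed.

Lemma cmod_eqP z x : `|z| = x%:C%C -> cmod z = x.
Proof. by rewrite /cmod => ->. Qed.

Lemma cmodM z w : cmod (z * w) = cmod z * cmod w.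
Proof. by apply: cmod_eqP; rewrite normrM !normE_cmod rmorphM. Qed.

Lemma cmod_ge0 z : 0 <= cmod z.
Proof. by have := normr_ge0 z; rewrite normE_cmod ler0c. Qed.

Lemma cmod0 : cmod 0 = 0. Proof. by rewrite /cmod normr0. Qed.

Lemma cmod1 : cmod 1 = 1. Proof. by rewrite /cmod normr1. Qed.

Lemma cmodN z : cmod (- z) = cmod z. Proof. by rewrite /cmod normrN. Qed.

Lemma cmodBC z w : cmod (z - w) = cmod (w - z).
Proof. by rewrite /cmod distrC. Qed.

Lemma cmod_eq0 z : (cmod z == 0) = (z == 0).
Proof. by rewrite -(normr_eq0 z) normE_cmod -complexr0 eq_complex /= eqxx andbT. Qed.

Lemma cmod_gt0 z : (0 < cmod z) = (z != 0).
Proof. by rewrite lt_def cmod_ge0 andbT cmod_eq0. Qed.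

Lemma cmodV z : cmod z^-1 = (cmod z)^-1.
Proof. by apply: cmod_eqP; rewrite normfV normE_cmod fmorphV. Qed.

Lemma cmodX z n : cmod (z ^+ n) = cmod z ^+ n.
Proof. by apply: cmod_eqP; rewrite normrX normE_cmod rmorphXn. Qed.

Lemma le_cmodD z w : cmod (z + w) <= cmod z + cmod w.
Proof. by have := ler_normD z w; rewrite !normE_cmod -rmorphD lecR. Qed.

Lemma le_cmodB z w : cmod (z - w) <= cmod z + cmod w.
Proof. by rewrite -(cmodN w) le_cmodD. Qed.

Lemma ge_cmodB z w : cmod z - cmod w <= cmod (z - w).
Proof. by rewrite lerBlDr -{1}(subrK w z) le_cmodD. Qed.

Lemma cmod_real x : cmod (x%:C%C : C) = `|x|.
Proof. by rewrite /cmod normc_def /= expr0n addr0 sqrtr_sqr. Qed.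

Lemma Re_le_cmod z : `|complex.Re z| <= cmod z.
Proof. by have := normc_ge_Re z; rewrite normE_cmod lecR. Qed.

Lemma cmodi : cmod ('i%C : C) = 1.
Proof. by rewrite /cmod normc_def /= expr0n add0r expr1n sqrtr1. Qed.

Lemma Im_le_cmod z : `|complex.Im z| <= cmod z.
Proof. by have := Re_le_cmod (z * 'i%C); rewrite ReiNIm normrN cmodM cmodi mulr1. Qed.

Lemma cmod_le_ReIm z : cmod z <= `|complex.Re z| + `|complex.Im z|.
Proof.
rewrite {1}[z]complexE; apply: le_trans (le_cmodD _ _) _.
by rewrite cmodM cmodi mul1r !cmod_real.
Qed.

Lemma continuousP_cmod (F : C -> C) z : {for z, continuous F} <->
  forall e, 0 < e -> exists2 d, 0 < d &
    forall w, cmod (w - z) < d -> cmod (F w - F z) < e.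
Proof.
split.
  move=> cF e e0; have {}cF := (@cvgrPdist_lt _ C _ (nbhs _) _ _ _).1 cF.
  have /cF/(@nbhs_ballP _ _) [d /= d0 dF] : 0 < e%:C%C :> C by rewrite ltcR.
  have dE : d = (complex.Re d)%:C%C by rewrite RRe_real // gtr0_real.
  exists (complex.Re d); first by move: d0; rewrite dE ltcR.
  move=> w wz; rewrite cmodBC -ltcR -normE_cmod; apply: dF.
  by rewrite /ball /= distrC dE normE_cmod ltcR.
move=> cF; apply: (@cvgrPdist_lt _ C _ (nbhs _) _ _ _).2 => e e0.
have eE : e = (complex.Re e)%:C%C by rewrite RRe_real // gtr0_real.
have [|d d0 dF] := cF (complex.Re e); first by move: e0; rewrite eE ltcR.
apply/(@nbhs_ballP _ C); exists d%:C%C; first by rewrite /= ltcR.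
move=> w; rewrite /ball /= distrC normE_cmod ltcR => /dF.
by rewrite cmodBC normE_cmod eE ltcR.
Qed.

Lemma continuousP_pathc (p : R -> C) x : {for x, continuous p} <->
  forall e, 0 < e -> exists2 d, 0 < d &
    forall t, `|t - x| < d -> cmod (p t - p x) < e.
Proof.
split.
  move=> cF e e0; have {}cF := (@cvgrPdist_lt _ C _ (nbhs _) _ _ _).1 cF.
  have /cF/(@nbhs_ballP _ _) [d /= d0 dF] : 0 < e%:C%C :> C by rewrite ltcR.
  exists d => // w wz; rewrite cmodBC -ltcR -normE_cmod; apply: dF.
  by rewrite /ball /= distrC.
move=> cF; apply: (@cvgrPdist_lt _ C _ (nbhs _) _ _ _).2 => e e0.
have eE : e = (complex.Re e)%:C%C by rewrite RRe_real // gtr0_real.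
have [|d d0 dF] := cF (complex.Re e); first by move: e0; rewrite eE ltcR.
apply/nbhs_ballP; exists d => // w.
rewrite /ball /= distrC => /dF.
by rewrite cmodBC normE_cmod eE ltcR.
Qed.

Lemma Re_continuous : continuous (@complex.Re R : C -> R).
Proof.
move=> z; apply: (@cvgrPdist_lt _ R _ (nbhs z) _ _ _).2 => e e0; apply/(@nbhs_ballP _ C).
exists e%:C%C; first by rewrite /= ltcR.
move=> w; rewrite /ball /= normE_cmod ltcR; apply: le_lt_trans.
by have := Re_le_cmod (z - w); rewrite raddfB.
Qed.

Lemma Im_continuous : continuous (@complex.Im R : C -> R).
Proof.
move=> z; apply: (@cvgrPdist_lt _ R _ (nbhs z) _ _ _).2 => e e0; apply/(@nbhs_ballP _ C).
exists e%:C%C; first by rewrite /= ltcR.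
move=> w; rewrite /ball /= normE_cmod ltcR; apply: le_lt_trans.
by have := Im_le_cmod (z - w); rewrite raddfB.
Qed.

Lemma cpt_continuousl y : continuous (cpt^~ y).
Proof.
move=> x; apply/continuousP_pathc => e e0; exists e => // t.
apply: le_lt_trans; apply: le_trans (cmod_le_ReIm _) _.
by rewrite /cpt /= subrr normr0 addr0.
Qed.

Lemma cpt_continuousr x : continuous (cpt x).
Proof.
move=> y; apply/continuousP_pathc => e e0; exists e => // t.
apply: le_lt_trans; apply: le_trans (cmod_le_ReIm _) _.
by rewrite /cpt /= subrr normr0 add0r.
Qed.

End Modulus.

(** * Goursat's lemma *)

Section SegmentIntegral.
Variable R : realType.
Local Notation C := (Cplx R).
Implicit Types (f g : R -> R) (a b c x : R).

Definition itg f a b : R := \int[@lebesgue_measure R]_(x in [set` `[a, b]]) f x.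

Lemma integrable_itv f a b : continuous f ->
  (@lebesgue_measure R).-integrable [set` `[a, b]] (EFin \o f).
Proof.
move=> cf; apply: continuous_compact_integrable; first exact: segment_compact.
by apply: continuous_subspaceT.
Qed.

Lemma itgD f g a b : continuous f -> continuous g ->
  itg (fun x => f x + g x) a b = itg f a b + itg g a b.
Proof. by move=> cf cg; rewrite /itg RintegralD //; exact: integrable_itv. Qed.

Lemma itgZ f r a b : continuous f -> itg (fun x => r * f x) a b = r * itg f a b.
Proof. by move=> cf; rewrite /itg RintegralZl //; exact: integrable_itv. Qed.

Lemma mulr_fun_continuous f r : continuous f -> continuous (fun x => r * f x).
Proof.
move=> cf x; apply: (@continuousM _ _ (fun=> r) f) (cf x).
exact: cst_continuous.
Qed.

Lemma itg_cst r a b : a <= b -> itg (fun=> r) a b = r * (b - a).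
Proof.
move=> ab; rewrite /itg Rintegral_cst //.
have /= := @lebesgue_measure_itv R `[a, b]; rewrite lte_fin => H; rewrite H.
by move: ab; case: ltgtP => // -> _; rewrite subrr mulr0.
Qed.

Lemma le_itg f g a b : continuous f -> continuous g ->
  (forall x, a <= x <= b -> f x <= g x) -> itg f a b <= itg g a b.
Proof.
by move=> cf cg fg; apply: le_Rintegral => //; exact: integrable_itv.
Qed.

Lemma itg_le f (M : R) a b : continuous f -> a <= b ->
  (forall x, a <= x <= b -> `|f x| <= M) -> `|itg f a b| <= M * (b - a).
Proof.
move=> cf ab fM; rewrite -(itg_cst _ ab) ler_norml.
have cc (r : R) : continuous (fun _ : R => r) by move=> ?; exact: cvg_cst.
rewrite -mulN1r -itgZ //; apply/andP; split; apply: le_itg => // x /fM;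
  by rewrite ler_norml ?mulN1r => /andP[].
Qed.

Lemma itg_chasles f a b c : continuous f -> a <= b -> b <= c ->
  itg f a c = itg f a b + itg f b c.
Proof.
move=> cf ab bc; apply/eqP; rewrite addrC -subr_eq; apply/eqP.
rewrite /itg Rintegral_itvB ?bnd_simp //; last exact: integrable_itv.
rewrite Rintegral_itv_obnd_cbnd //.
apply: (integrableS _ _ _ (integrable_itv b c cf)) => //.
by apply: subset_itv; rewrite ?bnd_simp.
Qed.

Lemma itg_id a b : a <= b -> itg id a b = (b ^+ 2 - a ^+ 2) / 2.
Proof.
rewrite le_eqVlt => /predU1P[->|ab].
  by rewrite subrr mul0r /itg set_itv1 Rintegral_set1.
rewrite /itg /Rintegral (@continuous_FTC2 _ id (fun x => x ^+ 2 / 2)) //.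
- by rewrite -EFinB /= mulrBl.
- by apply: continuous_subspaceT => x; exact: cvg_id.
- have cx : continuous (fun x : R => x ^+ 2 / 2).
    move=> x; apply: (@continuousM _ _ (fun x : R => x ^+ 2) (fun=> 2^-1));
      last exact: cst_continuous.
    exact: exprn_continuous.
  split.
  + by move=> x _.
  + by apply: cvg_at_right_filter; exact: cx.
  + by apply: cvg_at_left_filter; exact: cx.
- move=> x _; rewrite derive1E deriveM // derive_cst exp_derive scaler0 add0r.
  by rewrite scalerA -[RHS]mulr1 /=; rewrite /GRing.scale /= expr1; field.
Qed.

Definition cint (p : R -> C) a b : C :=
  cpt (itg (fun t => complex.Re (p t)) a b) (itg (fun t => complex.Im (p t)) a b).

Section ComplexPaths.
Implicit Types p q : R -> C.

Lemma Re_path_continuous p : continuous p -> continuous (fun t => complex.Re (p t)).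
Proof. by move=> cp x; apply: continuous_comp (cp x) (@Re_continuous R _). Qed.

Lemma Im_path_continuous p : continuous p -> continuous (fun t => complex.Im (p t)).
Proof. by move=> cp x; apply: continuous_comp (cp x) (@Im_continuous R _). Qed.

Lemma cintD p q a b : continuous p -> continuous q ->
  cint (fun t => p t + q t) a b = cint p a b + cint q a b.
Proof.
move=> cp cq; rewrite /cint /cpt; congr Complex.
  rewrite -itgD; [|exact: Re_path_continuous..].
  by apply: eq_Rintegral => x _; rewrite raddfD.
rewrite -itgD; [|exact: Im_path_continuous..].
by apply: eq_Rintegral => x _; rewrite raddfD.
Qed.

Lemma cintZ (c : C) p a b : continuous p -> cint (fun t => c * p t) a b = c * cint p a b.
Proof.
move=> cp; have cR := Re_path_continuous cp; have cI := Im_path_continuous cp.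
case: c => u v; rewrite /cint /cpt /= /GRing.mul /=; congr Complex.
  rewrite -mulNr -!itgZ // -itgD; last 2 first.
  - exact: mulr_fun_continuous.
  - exact: mulr_fun_continuous.
  by apply: eq_Rintegral => x _; case: (p x) => r s /=; rewrite mulNr.
rewrite -!itgZ // -itgD; last 2 first.
- exact: mulr_fun_continuous.
- exact: mulr_fun_continuous.
by apply: eq_Rintegral => x _; case: (p x) => r s /=.
Qed.

(** The factor 2 comes from bounding the real and imaginary parts separately; later arguments only
    need some absolute constant. *)
Lemma cint_le p (M : R) a b : continuous p -> a <= b ->
  (forall x, a <= x <= b -> cmod (p x) <= M) -> cmod (cint p a b) <= 2 * M * (b - a).
Proof.
move=> cp ab pM; apply: le_trans (cmod_le_ReIm _) _; rewrite /= -mulrA mulr_natl mulr2n.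
apply: lerD; apply: itg_le => //; try exact: Re_path_continuous;
  try exact: Im_path_continuous; move=> x /pM; apply: le_trans.
  exact: Re_le_cmod.
exact: Im_le_cmod.
Qed.

Lemma cint_chasles p a b c : continuous p -> a <= b -> b <= c ->
  cint p a c = cint p a b + cint p b c.
Proof.
move=> cp ab bc; rewrite /cint /cpt.
rewrite (itg_chasles (Re_path_continuous cp) ab bc).
by rewrite (itg_chasles (Im_path_continuous cp) ab bc).
Qed.

Lemma eq_cint p q a b : p =1 q -> cint p a b = cint q a b.
Proof. by move=> /funext ->. Qed.

End ComplexPaths.
End SegmentIntegral.

Section Goursat.
Variable R : realType.
Local Notation C := (Cplx R).
Implicit Types (F G : C -> C) (x y : R).

(** The integral of F dz along the boundary of the rectangle, counterclockwise: bottom, right, top,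
    left, with dz = i dt on the vertical sides. *)
Definition rint F x0 x1 y0 y1 : C :=
  cint (fun t => F (cpt t y0)) x0 x1 + 'i%C * cint (fun t => F (cpt x1 t)) y0 y1
  - cint (fun t => F (cpt t y1)) x0 x1 - 'i%C * cint (fun t => F (cpt x0 t)) y0 y1.

Definition in_rect x0 x1 y0 y1 (z : C) :=
  (x0 <= complex.Re z <= x1) && (y0 <= complex.Im z <= y1).

(* Complex differentiability in Caratheodory's form: when it holds at [x], [phi]
   is a divided slope (q(w) - q(x)) / (w - x) defined and continuous also at [x]. *)
Definition cdiff_at F z := exists2 phi : C -> C, {for z, continuous phi} &
  forall w, F w = F z + phi w * (w - z).

Lemma path_continuousl F y : continuous F -> continuous (fun t => F (cpt t y)).
Proof.
move=> cF x.
exact: (@continuous_comp _ _ C (fun t => cpt t y) F x (@cpt_continuousl _ y x) (cF _)).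
Qed.

Lemma path_continuousr F x : continuous F -> continuous (fun t => F (cpt x t)).
Proof.
move=> cF y.
exact: (@continuous_comp _ _ C (fun t => cpt x t) F y (@cpt_continuousr _ x y) (cF _)).
Qed.

Lemma addr_fun_continuous F G : continuous F -> continuous G ->
  continuous (fun z => F z + G z).
Proof. by move=> cF cG z; exact: (@continuousD C C C F G z (cF z) (cG z)). Qed.

Lemma mulr_fun_continuousC F G : continuous F -> continuous G ->
  continuous (fun z => F z * G z).
Proof. by move=> cF cG z; exact: (@continuousM C C F G z (cF z) (cG z)). Qed.

Lemma cst_fun_continuous (c : C) : continuous (fun _ : C => c).
Proof. by move=> z; exact: (@cst_continuous C C). Qed.

Lemma rintD F G x0 x1 y0 y1 : continuous F -> continuous G ->
  rint (fun z => F z + G z) x0 x1 y0 y1 = rint F x0 x1 y0 y1 + rint G x0 x1 y0 y1.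
Proof.
move=> cF cG; rewrite /rint.
rewrite (cintD x0 x1 (@path_continuousl F y0 cF) (@path_continuousl G y0 cG)).
rewrite (cintD x0 x1 (@path_continuousl F y1 cF) (@path_continuousl G y1 cG)).
rewrite (cintD y0 y1 (@path_continuousr F x0 cF) (@path_continuousr G x0 cG)).
rewrite (cintD y0 y1 (@path_continuousr F x1 cF) (@path_continuousr G x1 cG)).
by ring.
Qed.

Lemma rintZ (c : C) F x0 x1 y0 y1 : continuous F ->
  rint (fun z => c * F z) x0 x1 y0 y1 = c * rint F x0 x1 y0 y1.
Proof.
move=> cF; rewrite /rint.
rewrite (cintZ c x0 x1 (@path_continuousl F y0 cF)).
rewrite (cintZ c x0 x1 (@path_continuousl F y1 cF)).
rewrite (cintZ c y0 y1 (@path_continuousr F x0 cF)).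
rewrite (cintZ c y0 y1 (@path_continuousr F x1 cF)).
by ring.
Qed.

Lemma rint_cst (c : C) x0 x1 y0 y1 : rint (fun=> c) x0 x1 y0 y1 = 0.
Proof. by rewrite /rint; ring. Qed.

Lemma rint_id x0 x1 y0 y1 : x0 <= x1 -> y0 <= y1 -> rint id x0 x1 y0 y1 = 0.
Proof.
move=> x01 y01; rewrite /rint /cint /cpt /= !itg_cst // -![itg (fun t => t) _ _]/(itg id _ _).
rewrite !itg_id //; apply/eqP; rewrite eq_complex /=; apply/andP; split; apply/eqP; by field.
Qed.

Lemma rint_splitx F x0 x1 x2 y0 y1 : continuous F -> x0 <= x1 -> x1 <= x2 ->
  rint F x0 x2 y0 y1 = rint F x0 x1 y0 y1 + rint F x1 x2 y0 y1.
Proof.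
move=> cF x01 x12; rewrite /rint.
rewrite (cint_chasles (@path_continuousl F y0 cF) x01 x12).
rewrite (cint_chasles (@path_continuousl F y1 cF) x01 x12).
by ring.
Qed.

Lemma rint_splity F x0 x1 y0 y1 y2 : continuous F -> y0 <= y1 -> y1 <= y2 ->
  rint F x0 x1 y0 y2 = rint F x0 x1 y0 y1 + rint F x0 x1 y1 y2.
Proof.
move=> cF y01 y12; rewrite /rint.
rewrite (cint_chasles (@path_continuousr F x0 cF) y01 y12).
rewrite (cint_chasles (@path_continuousr F x1 cF) y01 y12).
by ring.
Qed.

Lemma rint_degx F x y0 y1 : continuous F -> rint F x x y0 y1 = 0.
Proof.
move=> cF; apply: (addrI (rint F x x y0 y1)).
by rewrite -rint_splitx // addr0.
Qed.

Lemma rint_degy F x0 x1 y : continuous F -> rint F x0 x1 y y = 0.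
Proof.
move=> cF; apply: (addrI (rint F x0 x1 y y)).
by rewrite -rint_splity // addr0.
Qed.

Lemma rint_le F (M : R) x0 x1 y0 y1 : continuous F -> x0 <= x1 -> y0 <= y1 ->
  (forall z, in_rect x0 x1 y0 y1 z -> cmod (F z) <= M) ->
  cmod (rint F x0 x1 y0 y1) <= 4 * M * ((x1 - x0) + (y1 - y0)).
Proof.
move=> cF x01 y01 FM; rewrite /rint.
have Hl y : y0 <= y <= y1 ->
    cmod (cint (fun t => F (cpt t y)) x0 x1) <= 2 * M * (x1 - x0).
  move=> hy; apply: cint_le => //; first exact: path_continuousl.
  by move=> x hx; apply: FM; rewrite /in_rect /= hx hy.
have Hr x : x0 <= x <= x1 ->
    cmod ('i%C * cint (fun t => F (cpt x t)) y0 y1) <= 2 * M * (y1 - y0).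
  move=> hx; rewrite cmodM cmodi mul1r.
  apply: cint_le => //; first exact: path_continuousr.
  by move=> y hy; apply: FM; rewrite /in_rect /= hx hy.
have := Hl y0; have := Hl y1; have := Hr x0; have := Hr x1.
rewrite !lexx x01 y01 /= => /(_ isT) H1 /(_ isT) H2 /(_ isT) H3 /(_ isT) H4.
apply: le_trans (le_cmodB _ _) _; apply: le_trans (lerD (le_cmodB _ _) (lexx _)) _.
apply: le_trans (lerD (lerD (le_cmodD _ _) (lexx _)) (lexx _)) _.
apply: le_trans (lerD (lerD (lerD H4 H1) H3) H2) _; lra.
Qed.

Lemma cmod_in_rect x0 x1 y0 y1 z w : in_rect x0 x1 y0 y1 z -> in_rect x0 x1 y0 y1 w ->
  cmod (z - w) <= (x1 - x0) + (y1 - y0).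
Proof.
move=> /andP[/andP[a1 a2] /andP[a3 a4]] /andP[/andP[b1 b2] /andP[b3 b4]].
apply: le_trans (cmod_le_ReIm _) _; rewrite !raddfB.
by apply: lerD; rewrite ler_norml; apply/andP; split; lra.
Qed.

Lemma affine_continuous (a b : C) : continuous (fun z : C => a + b * z).
Proof.
apply: addr_fun_continuous; first exact: cst_fun_continuous.
apply: (mulr_fun_continuousC (@cst_fun_continuous b)) => z; exact: cvg_id.
Qed.

Lemma rint_affine (a b : C) x0 x1 y0 y1 : x0 <= x1 -> y0 <= y1 ->
  rint (fun z => a + b * z) x0 x1 y0 y1 = 0.
Proof.
move=> x01 y01; have cid : continuous (fun z : C => z) by move=> z; exact: cvg_id.
rewrite (@rintD (fun=> a) (fun z => b * z)); last 2 first.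
- exact: cst_fun_continuous.
- exact: (mulr_fun_continuousC (@cst_fun_continuous b) cid).
by rewrite rint_cst (@rintZ b id) // rint_id // mulr0 addr0.
Qed.

(** Subtracting the affine approximation of [F] at [p], whose boundary integral vanishes, leaves the
    remainder (phi z - phi p) (z - p). Near [p] it is at most e / 4 times the half-perimeter s, and
    [rint_le] contributes the factor 4 s. *)
Lemma cdiff_rint_small F p (e : R) : continuous F -> cdiff_at F p -> 0 < e ->
  exists2 d, 0 < d & forall x0 x1 y0 y1, x0 <= x1 -> y0 <= y1 ->
    in_rect x0 x1 y0 y1 p -> (x1 - x0) + (y1 - y0) < d ->
    cmod (rint F x0 x1 y0 y1) <= e * ((x1 - x0) + (y1 - y0)) ^+ 2.
Proof.
move=> cF [phi /continuousP_cmod cphi Fphi] e0.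
have [|d d0 hd] := cphi (e / 4); first by rewrite divr_gt0.
exists d => // x0 x1 y0 y1 x01 y01 pr sd; set s := _ + _ in sd *.
pose r z := F z + ((phi p * p - F p) + (- phi p) * z).
have cr : continuous r by apply: (addr_fun_continuous cF); exact: affine_continuous.
have -> : rint F x0 x1 y0 y1 = rint r x0 x1 y0 y1.
  rewrite (rintD _ _ _ _ cF); last exact: affine_continuous.
  by rewrite rint_affine // addr0.
have rM z : in_rect x0 x1 y0 y1 z -> cmod (r z) <= e / 4 * s.
  move=> zr; have zp := cmod_in_rect zr pr.
  have -> : r z = (phi z - phi p) * (z - p) by rewrite /r Fphi; ring.
  rewrite cmodM; apply: ler_pM; rewrite ?cmod_ge0 //.
  by apply/ltW/hd; exact: le_lt_trans sd.
by apply: le_trans (rint_le cr x01 y01 rM) _; rewrite -/s le_eqVlt; apply/orP; left;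
  apply/eqP; field.
Qed.

Lemma nested_itv (a b : nat -> R) : (forall n, a n <= a n.+1) ->
  (forall n, b n.+1 <= b n) -> (forall n, a n <= b n) ->
  exists l, forall n, a n <= l <= b n.
Proof.
move=> ha hb hab.
have ham : {homo a : m n / (m <= n)%N >-> m <= n} by apply: homo_leq => //; exact: le_trans.
have hbm : {homo b : m n / (m <= n)%N >-> n <= m}.
  by apply: homo_leq => // y x z; rewrite /= => h1 h2; exact: le_trans h2 h1.
have habm m n : a m <= b n.
  by apply: le_trans (ham _ (maxn m n) (leq_maxl _ _)) (le_trans (hab _) (hbm _ _ (leq_maxr _ _))).
have hs : has_sup [set a n | n in [set: nat]]%classic.
  by split; [exists (a 0%N), 0%N | exists (b 0%N) => _ [n _ <-]].
exists (sup [set a n | n in [set: nat]]%classic) => n; apply/andP; split.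
  by apply: (sup_upper_bound hs); exists n.
by apply: ge_sup; [exists (a 0%N), 0%N | move=> _ [m _ <-]].
Qed.

Definition wf_rect (q : R * R * R * R) :=
  let: (x0, x1, y0, y1) := q in (x0 <= x1) && (y0 <= y1).
Definition half_perim (q : R * R * R * R) :=
  let: (x0, x1, y0, y1) := q in (x1 - x0) + (y1 - y0).
Definition qrint F (q : R * R * R * R) :=
  let: (x0, x1, y0, y1) := q in rint F x0 x1 y0 y1.

Definition quarter (q q' : R * R * R * R) :=
  let: (x0, x1, y0, y1) := q in let: (x0', x1', y0', y1') := q' in
  [/\ x0 <= x0', x1' <= x1, y0 <= y0', y1' <= y1 &
      x1' - x0' = (x1 - x0) / 2 /\ y1' - y0' = (y1 - y0) / 2].

(** Halving the sides divides the bound by 4, so four quarters obeying it would add up to the bound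
    for the whole rectangle. *)
Lemma bad_quarter F (e : R) (q : R * R * R * R) : continuous F -> wf_rect q ->
  e * half_perim q ^+ 2 < cmod (qrint F q) ->
  exists q', [/\ wf_rect q', quarter q q' & e * half_perim q' ^+ 2 < cmod (qrint F q')].
Proof.
case: q => [[[x0 x1] y0] y1] /= cF /andP[x01 y01] bad.
pose xm := (x0 + x1) / 2; pose ym := (y0 + y1) / 2.
have hx : x0 <= xm <= x1 by apply/andP; split; rewrite /xm; lra.
have hy : y0 <= ym <= y1 by apply/andP; split; rewrite /ym; lra.
have [hxm hxm' hym hym'] : [/\ xm - x0 = (x1 - x0) / 2, x1 - xm = (x1 - x0) / 2,
    ym - y0 = (y1 - y0) / 2 & y1 - ym = (y1 - y0) / 2].
  by rewrite /xm /ym; split; lra.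
have [hx0 hx1] := andP hx; have [hy0 hy1] := andP hy.
set s := _ + _ in bad.
apply: contrapT => no.
have small q' : wf_rect q' -> quarter (x0, x1, y0, y1) q' ->
    cmod (qrint F q') <= e * (s / 2) ^+ 2.
  move=> wq qq; rewrite leNgt; apply/negP => bq; apply: no; exists q'; split => //.
  suff -> : half_perim q' = s / 2 by [].
  by case: q' qq {wq bq} => [[[? ?] ?] ?] /= [_ _ _ _ [-> ->]]; rewrite /s; lra.
move: bad; rewrite (rint_splitx y0 y1 cF hx0 hx1).
rewrite (rint_splity x0 xm cF hy0 hy1) (rint_splity xm x1 cF hy0 hy1).
apply/negP; rewrite -leNgt.
have h1 := small (x0, xm, y0, ym); have h2 := small (x0, xm, ym, y1).
have h3 := small (xm, x1, y0, ym); have h4 := small (xm, x1, ym, y1).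
apply: le_trans (le_cmodD _ _) _.
apply: le_trans (lerD (le_cmodD _ _) (le_cmodD _ _)) _.
have {}h1 := h1 _ _; have {}h2 := h2 _ _; have {}h3 := h3 _ _; have {}h4 := h4 _ _.
apply: (@le_trans _ _ (e * (s / 2) ^+ 2 + e * (s / 2) ^+ 2 +
  (e * (s / 2) ^+ 2 + e * (s / 2) ^+ 2))).
  apply: lerD; apply: lerD; [apply: h1|apply: h2|apply: h3|apply: h4] => /=;
    by rewrite ?hx0 ?hx1 ?hy0 ?hy1.
by rewrite le_eqVlt; apply/orP; left; apply/eqP; field.
Qed.

Lemma goursat F x0 x1 y0 y1 : continuous F -> x0 <= x1 -> y0 <= y1 ->
  (forall z, in_rect x0 x1 y0 y1 z -> cdiff_at F z) -> rint F x0 x1 y0 y1 = 0.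
Proof.
move=> cF x01 y01 dF; apply/eqP; rewrite -cmod_eq0 eq_le cmod_ge0 andbT.
set q0 := (x0, x1, y0, y1).
(* With I the integral and s the half-perimeter, the bound is tested at e = |I| / (s^2 + 1); the
   summand 1 covers a rectangle reduced to a point. *)
suff H (e : R) : 0 < e -> cmod (qrint F q0) <= e * half_perim q0 ^+ 2.
  apply: contrapT => /negP; rewrite -ltNge => c0.
  have hp : 0 < half_perim q0 ^+ 2 + 1 by rewrite ltr_wpDl ?sqr_ge0.
  have := H (cmod (qrint F q0) / (half_perim q0 ^+ 2 + 1)); rewrite divr_gt0 // => /(_ isT).
  rewrite mulrAC ler_pdivlMr // ler_pM2l //; lra.
move=> e0; rewrite leNgt; apply/negP => bad0.
pose bad q := wf_rect q /\ e * half_perim q ^+ 2 < cmod (qrint F q).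
(* Keeping the proof of badness in the type makes the choice of a bad quarter a function that can be
   iterated. *)
have step (q : {q | bad q}) : {q' : {q | bad q} | quarter (sval q) (sval q')}.
  case: q => q [wq bq]; apply: cid.
  by have [q' [w1 w2 w3]] := bad_quarter cF wq bq; exists (exist _ q' (conj w1 w3)).
have b0 : bad q0 by split => //=; rewrite x01 y01.
pose Q := fix Q n := if n is n'.+1 then sval (step (Q n')) else exist _ q0 b0.
have QS n : quarter (sval (Q n)) (sval (Q n.+1)) by exact: (svalP (step (Q n))).
have wQ n : wf_rect (sval (Q n)) by case: (Q n) => ? [].
pose X0 n := (sval (Q n)).1.1.1; pose X1 n := (sval (Q n)).1.1.2.
pose Y0 n := (sval (Q n)).1.2; pose Y1 n := (sval (Q n)).2.
have QE n : sval (Q n) = (X0 n, X1 n, Y0 n, Y1 n).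
  by rewrite /X0 /X1 /Y0 /Y1; case: (sval (Q n)) => [[[]]].
have wQ' n : X0 n <= X1 n /\ Y0 n <= Y1 n by apply/andP; have := wQ n; rewrite QE.
have QS' n : [/\ X0 n <= X0 n.+1, X1 n.+1 <= X1 n, Y0 n <= Y0 n.+1, Y1 n.+1 <= Y1 n &
   X1 n.+1 - X0 n.+1 = (X1 n - X0 n) / 2 /\ Y1 n.+1 - Y0 n.+1 = (Y1 n - Y0 n) / 2].
  by have := QS n; rewrite !QE.
have [px hpx] : exists l, forall n, X0 n <= l <= X1 n.
  by apply: nested_itv => n; [case: (QS' n) | case: (QS' n) | case: (wQ' n)].
have [py hpy] : exists l, forall n, Y0 n <= l <= Y1 n.
  by apply: nested_itv => n; [case: (QS' n) | case: (QS' n) | case: (wQ' n)].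
have [|d d0 hd] := @cdiff_rint_small F (cpt px py) e cF _ e0.
  by apply: dF; rewrite /in_rect /= (hpx 0%N) (hpy 0%N).
have hs n : half_perim (sval (Q n)) = half_perim q0 / 2 ^+ n.
  elim: n => [|n IHn]; first by rewrite expr0 divr1.
  transitivity (half_perim (sval (Q n)) / 2); last by rewrite IHn exprSr invfM mulrA.
  by rewrite !QE /=; case: (QS' n) => _ _ _ _ [-> ->]; rewrite -mulrDl.
have hp0 : 0 <= half_perim q0 by rewrite /=; lra.
(* As 2^n > n >= s / d for the initial half-perimeter s, the n-th rectangle is smaller than [d]. *)
pose n := Num.bound (half_perim q0 / d).
have sn : half_perim (sval (Q n)) < d.
  rewrite hs ltr_pdivrMr ?exprn_gt0 // mulrC -ltr_pdivrMr //.
  apply: lt_trans (archi_boundP _) _; first by rewrite divr_ge0 // ltW.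
  by rewrite -natrX ltr_nat ltn_expl.
have [_ bn] : bad (sval (Q n)) by exact: (svalP (Q n)).
move: bn sn; rewrite QE /=; have [wx wy] := wQ' n => bn sn.
have := hd _ _ _ _ wx wy _ sn; rewrite /in_rect /= (hpx n) (hpy n) => /(_ isT).
by rewrite leNgt bn.
Qed.

(** [l] is the left edge of a small core around [p]. By the last clause the strip from [a] to [l]
    either misses [p] or has width zero. *)
Lemma shrink_left (a p e : R) : a <= p -> 0 < e ->
  exists l, [/\ a <= l, l <= p, p - e <= l & l = p -> a = l].
Proof.
move=> ap e0; have [h|h] := leP a (p - e).
  by exists (p - e); split => //; [lra | move=> h'; lra].
by exists a; split => //; lra.
Qed.

Lemma shrink_right (b p e : R) : p <= b -> 0 < e ->
  exists r, [/\ r <= b, p <= r, r <= p + e & r = p -> b = r].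
Proof.
move=> pb e0; have [h|h] := leP b (p + e).
  by exists b; split => //; lra.
by exists (p + e); split => //; [lra | lra | move=> h'; lra].
Qed.

(** Exceptional points are removed one at a time. Four strips around a small core containing [p]
    miss [p] or are degenerate, so they integrate to 0; the integral over the core tends to 0 with
    its perimeter because [F] is bounded near [p]. *)
Lemma goursat_except (E : seq C) F x0 x1 y0 y1 : continuous F -> x0 <= x1 -> y0 <= y1 ->
  (forall z, in_rect x0 x1 y0 y1 z -> z \notin E -> cdiff_at F z) ->
  rint F x0 x1 y0 y1 = 0.
Proof.
move=> cF; elim: E x0 x1 y0 y1 => [|p E IHE] x0 x1 y0 y1 x01 y01 dF.
  by apply: goursat => // z zr; exact: dF.
have sub u0 u1 v0 v1 : x0 <= u0 -> u0 <= u1 -> u1 <= x1 -> y0 <= v0 -> v0 <= v1 -> v1 <= y1 ->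
    ~~ in_rect u0 u1 v0 v1 p -> rint F u0 u1 v0 v1 = 0.
  move=> h1 h2 h3 h4 h5 h6 pn; apply: IHE => // z zr zE; apply: dF.
    case/andP: zr => /andP[a1 a2] /andP[a3 a4]; rewrite /in_rect.
    by rewrite (le_trans h1 a1) (le_trans a2 h3) (le_trans h4 a3) (le_trans a4 h6).
  by rewrite inE negb_or zE andbT; apply: contraNneq pn => <-.
have [pr|pr] := boolP (in_rect x0 x1 y0 y1 p); last by apply: sub.
have [/andP[px0 px1] /andP[py0 py1]] := andP pr.
have /continuousP_cmod/(_ 1 ltr01) [d d0 hd] := cF p.
(* The core has sides at most 2 e, hence half-perimeter at most 4 e, and e < d / 2 keeps it in the
   disc where [F] is within 1 of [F p]. *)
have key (e : R) : 0 < e -> e < d / 2 ->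
    cmod (rint F x0 x1 y0 y1) <= 4 * (cmod (F p) + 1) * (4 * e).
  move=> e0 ed; set px := complex.Re p in px0 px1; set py := complex.Im p in py0 py1.
  have [xl [xl1 xl2 xl3 xl4]] := shrink_left px0 e0.
  have [xr [xr1 xr2 xr3 xr4]] := shrink_right px1 e0.
  have [yl [yl1 yl2 yl3 yl4]] := shrink_left py0 e0.
  have [yr [yr1 yr2 yr3 yr4]] := shrink_right py1 e0.
  have rl : rint F x0 xl y0 y1 = 0.
    have [/xl4 <-|n] := eqVneq xl px; first exact: rint_degx.
    apply: sub => //; first lra.
    by rewrite /in_rect -/px; apply/negP => /andP[/andP[_ h] _]; case/eqP: n; lra.
  have rr : rint F xr x1 y0 y1 = 0.
    have [/xr4 <-|n] := eqVneq xr px; first exact: rint_degx.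
    apply: sub => //; first lra.
    by rewrite /in_rect -/px; apply/negP => /andP[/andP[h _] _]; case/eqP: n; lra.
  have rb : rint F xl xr y0 yl = 0.
    have [/yl4 <-|n] := eqVneq yl py; first exact: rint_degy.
    apply: sub => //; [lra | lra |].
    by rewrite /in_rect -/py; apply/negP => /andP[_ /andP[_ h]]; case/eqP: n; lra.
  have rt : rint F xl xr yr y1 = 0.
    have [/yr4 <-|n] := eqVneq yr py; first exact: rint_degy.
    apply: sub => //; [lra | lra |].
    by rewrite /in_rect -/py; apply/negP => /andP[_ /andP[h _]]; case/eqP: n; lra.
  rewrite (rint_splitx _ _ cF xl1 (le_trans xl2 px1)) rl add0r.
  rewrite (rint_splitx _ _ cF (le_trans xl2 xr2) xr1) rr addr0.
  rewrite (rint_splity _ _ cF yl1 (le_trans yl2 py1)) rb add0r.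
  rewrite (rint_splity _ _ cF (le_trans yl2 yr2) yr1) rt addr0.
  have mM z : in_rect xl xr yl yr z -> cmod (F z) <= cmod (F p) + 1.
    move=> /andP[/andP[z1 z2] /andP[z3 z4]].
    have /hd hz : cmod (z - p) < d.
      apply: le_lt_trans (cmod_le_ReIm _) _; rewrite !raddfB -/px -/py.
      apply: (@le_lt_trans _ _ (e + e)); last lra.
      by apply: lerD; rewrite ler_norml; apply/andP; split; lra.
    by rewrite -(subrK (F p) (F z)); apply: le_trans (le_cmodD _ _) _; lra.
  apply: le_trans (rint_le cF _ _ mM) _; [lra | lra |].
  apply: ler_wpM2l; last lra.
  by have := cmod_ge0 (F p); lra.
apply/eqP; rewrite -cmod_eq0 eq_le cmod_ge0 andbT.
apply: contrapT => /negP; rewrite -ltNge; set c := cmod _ => c0.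
have Fp0 : 0 < cmod (F p) + 1 by rewrite ltr_wpDl ?cmod_ge0.
(* The second term makes the bound of [key], which is 16 (cmod (F p) + 1) e, at most c / 2. *)
pose e := Num.min (d / 4) (c / (32 * (cmod (F p) + 1))).
have e0 : 0 < e by rewrite lt_min !divr_gt0 // mulr_gt0.
have ed : e < d / 2 by apply: (@le_lt_trans _ _ (d / 4)); [rewrite ge_min lexx | lra].
have := key e e0 ed; apply/negP; rewrite -ltNge.
have : e <= c / (32 * (cmod (F p) + 1)) by rewrite ge_min lexx orbT.
rewrite ler_pdivlMr ?mulr_gt0 //; rewrite -/c; lra.
Qed.

End Goursat.

(** * Liouville's theorem *)

Section Liouville.
Variable R : realType.
Local Notation C := (Cplx R).
Implicit Types (q : C -> C) (E : seq C).

Lemma near_neq (w x : C) : w != x -> \forall w' \near nbhs w, w' != x.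
Proof.
move=> wx; apply/(@nbhs_ballP _ C); exists `|w - x|; first by rewrite /= normr_gt0 subr_eq0.
move=> w'; rewrite /ball /=; apply: contraTneq => ->; by rewrite ltxx.
Qed.

(** Off [x], [phi] inherits differentiability by algebra: its slope at w is (psi - phi) / (w - x),
    with psi the slope of [q] at w. At [x] itself only continuity is at hand, so [x] joins the
    exceptional set. *)
Lemma divided_slope q E x : continuous q -> (forall z, z \notin E -> cdiff_at q z) -> x \notin E ->
  exists phi : C -> C, [/\ continuous phi,
    forall z, z \notin x :: E -> cdiff_at phi z &
    forall w, q w = q x + phi w * (w - x)].
Proof.
move=> cq dq xE; have [phi cphi qphi] := dq x xE.
have cphi' : continuous phi.
  move=> w; have [->//|wx] := eqVneq w x.
  have cid : {for w, continuous (fun w' : C => w' - x)}.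
    by apply: (@continuousB C C C id (fun=> x)); [exact: cvg_id | exact: (@cst_continuous C C)].
  have cF : {for w, continuous (fun w' => (q w' - q x) * (w' - x)^-1)}.
    apply: (@continuousM C C (fun w' => q w' - q x) (fun w' => (w' - x)^-1)).
      by apply: (@continuousB C C C q (fun=> q x)); [exact: cq | exact: (@cst_continuous C C)].
    by apply: (@continuousV C C (fun w' => w' - x)) => //; rewrite subr_eq0.
  have phiE w' : w' != x -> (q w' - q x) * (w' - x)^-1 = phi w'.
    by move=> w'x; rewrite qphi [q x + _]addrC addrK mulfK // subr_eq0.
  rewrite /prop_for /continuous_at -(phiE w wx); apply: cvg_trans cF.
  apply: (@near_eq_cvg _ _ (nbhs w)).
  by apply: filterS (near_neq wx) => w' /phiE.
exists phi; split => // w; rewrite inE negb_or => /andP[wx wE].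
have [psi cpsi qpsi] := dq w wE.
exists (fun w' => (psi w' - phi w') * (w - x)^-1).
  apply: (@continuousM C C (fun w' => psi w' - phi w') (fun=> (w - x)^-1)).
    by apply: (@continuousB C C C psi phi); [exact: cpsi | exact: cphi'].
  exact: (@cst_continuous C C).
move=> w'; have wx0 : w - x != 0 by rewrite subr_eq0.
have := qpsi w'; rewrite (qphi w') (qphi w) => h.
apply: (mulIf wx0); rewrite mulrDl [_ * _^-1 * _]mulrAC mulfVK //.
transitivity (phi w' * (w' - x) - phi w' * (w' - w)); first by ring.
have -> : phi w' * (w' - x) = q x + phi w * (w - x) + psi w' * (w' - w) - q x by rewrite -h; ring.
by ring.
Qed.

Lemma inv_path_continuous (p : R -> C) (a : C) : continuous p -> (forall t, p t != a) ->
  continuous (fun t => (p t - a)^-1).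
Proof.
move=> cp pa t; apply: (@continuousV C R (fun t => p t - a)); first by rewrite subr_eq0.
by apply: (@continuousB C C R p (fun=> a)); [exact: cp | exact: (@cst_continuous R C)].
Qed.

(** Along the path, phi + q a / (z - a) equals q / (z - a), which is at most M / S^2. The parameter
    interval has length 2 S, and [cint_le] adds a factor 2. *)
Lemma side_estimate q phi (p : R -> C) (a : C) (S M l r : R) :
  continuous q -> continuous p -> 0 < S -> l <= r -> r - l = 2 * S ->
  (forall w, q w = q a + phi w * (w - a)) ->
  (forall t, S <= cmod (p t - a)) -> (forall t, cmod (q (p t)) <= M / S) ->
  cmod (cint (fun t => phi (p t)) l r + q a * cint (fun t => (p t - a)^-1) l r) <= 4 * M / S.
Proof.
move=> cq cp S0 lr hlr qphi pS qM.
have pa t : p t != a.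
  apply: contraTneq (pS t) => ->; by rewrite subrr cmod0 -ltNge.
have cJ := inv_path_continuous cp pa.
have cqp : continuous (fun t => q (p t)).
  by move=> t; exact: (@continuous_comp _ _ C p q t (cp t) (cq _)).
pose Q t := q (p t) * (p t - a)^-1.
have cQ : continuous Q.
  by move=> t; exact: (@continuousM C R _ _ t (cqp t) (cJ t)).
have cqJ : continuous (fun t => (- q a) * (p t - a)^-1).
  move=> t; apply: (@continuousM C R (fun=> - q a) (fun t => (p t - a)^-1)).
    exact: (@cst_continuous R C).
  exact: cJ.
have -> : cint (fun t => phi (p t)) l r = cint (fun t => Q t + (- q a) * (p t - a)^-1) l r.
  apply: eq_cint => t; rewrite /Q -mulrDl qphi [q a + _]addrC addrK mulfK //.
  by rewrite subr_eq0.
rewrite (cintD _ _ cQ cqJ) (cintZ _ _ _ cJ) mulNr subrK.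
apply: (@le_trans _ _ (2 * (M / S / S) * (r - l))).
  apply: cint_le => // t _; rewrite /Q cmodM cmodV.
  apply: ler_pM; rewrite ?cmod_ge0 ?invr_ge0 ?cmod_ge0 //.
  by rewrite lef_pV2 // ?posrE //; apply: lt_le_trans (pS t).
rewrite hlr le_eqVlt; apply/orP; left; apply/eqP; field.
by rewrite gt_eqF.
Qed.

(** Since |t - c| <= S, the integrand is at least 1 / (2 S). The exact value is pi / 2, but Cauchy's
    formula will only need a constant bounded away from 0. *)
Lemma itg_ge1 (f : R -> R) (S c : R) : continuous f -> 0 < S ->
  (forall t, c - S <= t <= c + S -> f t = S / ((t - c) ^+ 2 + S ^+ 2)) ->
  1 <= itg f (c - S) (c + S).
Proof.
move=> cf S0 fE; have le : c - S <= c + S by lra.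
have -> : 1 = itg (fun=> (2 * S)^-1) (c - S) (c + S).
  by rewrite itg_cst //; field; rewrite gt_eqF.
apply: le_itg => //; first by move=> ?; exact: cvg_cst.
move=> t /[dup] ht /andP[ht1 ht2]; rewrite fE // -div1r ler_pdivrMr ?mulr_gt0 // mulrAC.
have pos : 0 < (t - c) ^+ 2 + S ^+ 2 by rewrite ltr_wpDl ?sqr_ge0 ?exprn_gt0.
rewrite ler_pdivlMr // mul1r.
have [h1 h2] : 0 <= S - (t - c) /\ 0 <= S + (t - c) by split; lra.
by have := mulr_ge0 h1 h2; rewrite !expr2; lra.
Qed.

(* The imaginary part of the integral of [1 / (z - a)] is at least 1 on each
   side of a square centred at [a]. *)
Lemma rint_inv_ge4 (a : C) (S : R) : 0 < S ->
  4 <= cmod (rint (fun z => (z - a)^-1) (complex.Re a - S) (complex.Re a + S)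
                  (complex.Im a - S) (complex.Im a + S)).
Proof.
case: a => u v S0; apply: le_trans (Im_le_cmod _); apply: le_trans (ler_norm _).
have S0' : S != 0 by rewrite gt_eqF.
have cl y : y != v -> continuous (fun t => (cpt t y - Complex u v : C)^-1).
  move=> yv; apply: inv_path_continuous; first exact: cpt_continuousl.
  by move=> t; rewrite eq_complex /= negb_and yv orbT.
have cr x : x != u -> continuous (fun t => (cpt x t - Complex u v : C)^-1).
  move=> xu; apply: inv_path_continuous; first exact: cpt_continuousr.
  by move=> t; rewrite eq_complex /= negb_and xu.
have n1 w : w - S != w by rewrite -subr_eq0 addrAC subrr add0r oppr_eq0.
have n2 w : w + S != w by rewrite -subr_eq0 addrAC subrr add0r.
have hb := @itg_ge1 _ S u (Im_path_continuous (cl _ (n1 v))) S0.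
have ht := @itg_ge1 _ S u (@mulr_fun_continuous _ _ (-1) (Im_path_continuous (cl _ (n2 v)))) S0.
have hr := @itg_ge1 _ S v (Re_path_continuous (cr _ (n2 u))) S0.
have hl := @itg_ge1 _ S v (@mulr_fun_continuous _ _ (-1) (Re_path_continuous (cr _ (n1 u)))) S0.
rewrite itgZ in ht; last exact: (Im_path_continuous (cl _ (n2 v))).
rewrite itgZ in hl; last exact: (Re_path_continuous (cr _ (n1 u))).
have e1 w : w - S - w = - S by ring.
have e2 w : w + S - w = S by ring.
rewrite /rint /cint /cpt /= !e1 !e2; rewrite /cpt /= ?e1 ?e2 in hb ht hr hl.
have {}hb := hb (fun t _ => _); have {}ht := ht (fun t _ => _).
have {}hr := hr (fun t _ => _); have {}hl := hl (fun t _ => _).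
apply: (@le_trans _ _ (1 + 1 + 1 + 1)); first lra.
rewrite !mul0r !add0r !mul1r; rewrite !mulN1r in ht hl.
apply: lerD; last apply: hl; last by move=> t; rewrite sqrrN mulN1r mulNr opprK addrC.
apply: lerD; last apply: ht; last by move=> t; rewrite mulN1r opprK.
apply: lerD; last by apply: hr => t; rewrite addrC.
by apply: hb => t; rewrite sqrrN mulNr opprK.
Qed.

Lemma square_sides_far (a : C) (S t : R) :
  let u := complex.Re a in let v := complex.Im a in
  [/\ S <= cmod (cpt t (v - S) - a), S <= cmod (cpt t (v + S) - a),
      S <= cmod (cpt (u - S) t - a) & S <= cmod (cpt (u + S) t - a)].
Proof.
have e1 (w : R) : w - S - w = - S by ring.
have e2 (w : R) : w + S - w = S by ring.
case: a => u v /=; split;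
  [apply: le_trans (Im_le_cmod _) | apply: le_trans (Im_le_cmod _) |
   apply: le_trans (Re_le_cmod _) | apply: le_trans (Re_le_cmod _)];
  by rewrite /= ?e1 ?e2 ?normrN ler_norm.
Qed.

(** On the square of half-side S centred at [a], the integral of [phi] vanishes; so [q a] times the
    integral of 1 / (z - a), of modulus at least 4, equals the integral of q / (z - a), which is O(1
    / S). *)
Lemma decay_eq0 q E (a : C) (M r : R) : continuous q ->
  (forall z, z \notin E -> cdiff_at q z) -> a \notin E ->
  (forall z, r <= cmod z -> cmod (q z) * cmod z <= M) -> q a = 0.
Proof.
move=> cq dq aE qM; have [phi [cphi dphi qphi]] := divided_slope cq dq aE.
have M0 : 0 <= M.
  apply: le_trans (qM (`|r|%:C%C) _); first by rewrite mulr_ge0 ?cmod_ge0.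
  by rewrite cmod_real normr_id ler_norm.
have key (S : R) : 0 < S -> 2 * cmod a <= S -> 2 * `|r| <= S ->
    cmod (q a) <= 8 * M / S.
  move=> S0 Sa Sr; set u := complex.Re a; set v := complex.Im a.
  (* S >= 2 |a| gives |z| >= S / 2, whence 2 M in place of M; S >= 2 |r| makes the decay hypothesis
     available. *)
  have far z : S <= cmod (z - a) -> cmod (q z) <= 2 * M / S.
    move=> Sz; have Sz2 : S / 2 <= cmod z.
      have := le_cmodB z a; lra.
    have z0 : 0 < cmod z by apply: lt_le_trans Sz2; rewrite divr_gt0.
    have rz : r <= cmod z by apply: le_trans (ler_norm _) _; lra.
    have qz : cmod (q z) <= M / cmod z by rewrite ler_pdivlMr //; exact: qM.
    apply: le_trans qz _; rewrite ler_pdivrMr //.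
    have -> : 2 * M / S * cmod z = M * (2 * cmod z / S) by ring.
    by rewrite ler_peMr // ler_pdivlMr // mul1r; lra.
  have side p l rr : continuous p -> l <= rr -> rr - l = 2 * S ->
      (forall t, S <= cmod (p t - a)) ->
      cmod (cint (fun t => phi (p t)) l rr + q a * cint (fun t => (p t - a)^-1) l rr)
      <= 4 * (2 * M) / S.
    by move=> cp lr hlr pS; apply: side_estimate => // t; exact: far.
  have uu : u - S <= u + S by lra.
  have vv : v - S <= v + S by lra.
  have du : u + S - (u - S) = 2 * S by ring.
  have dv : v + S - (v - S) = 2 * S by ring.
  have h1 := @side (fun t => cpt t (v - S)) _ _ (@cpt_continuousl _ _) uu du.
  have h2 := @side (fun t => cpt t (v + S)) _ _ (@cpt_continuousl _ _) uu du.
  have h3 := @side (fun t => cpt (u - S) t) _ _ (@cpt_continuousr _ _) vv dv.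
  have h4 := @side (fun t => cpt (u + S) t) _ _ (@cpt_continuousr _ _) vv dv.
  have hyp t : [/\ S <= cmod (cpt t (v - S) - a), S <= cmod (cpt t (v + S) - a),
      S <= cmod (cpt (u - S) t - a) & S <= cmod (cpt (u + S) t - a)].
    exact: square_sides_far.
  have {}h1 := h1 (fun t => let: And4 h _ _ _ := hyp t in h).
  have {}h2 := h2 (fun t => let: And4 _ h _ _ := hyp t in h).
  have {}h3 := h3 (fun t => let: And4 _ _ h _ := hyp t in h).
  have {}h4 := h4 (fun t => let: And4 _ _ _ h := hyp t in h).
  have g0 : rint phi (u - S) (u + S) (v - S) (v + S) = 0.
    by apply: (@goursat_except _ (a :: E)) => // z _; exact: dphi.
  have g4 := rint_inv_ge4 a S0.
  rewrite -/u -/v in g4.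
  have {}g4 : 4 * cmod (q a) <=
      cmod (q a * rint (fun z => (z - a)^-1) (u - S) (u + S) (v - S) (v + S)).
    by rewrite cmodM mulrC ler_wpM2l ?cmod_ge0.
  move: g0 g4 h1 h2 h3 h4; rewrite /rint.
  set b1 := cint _ _ _; set b2 := cint _ _ _; set b3 := cint _ _ _; set b4 := cint _ _ _.
  set c1 := cint _ _ _; set c2 := cint _ _ _; set c3 := cint _ _ _; set c4 := cint _ _ _.
  move=> g0 g4 h1 h2 h3 h4.
  have : cmod (q a * (c1 + 'i%C * c2 - c3 - 'i%C * c4)) <= 4 * (4 * (2 * M) / S).
    have -> : q a * (c1 + 'i%C * c2 - c3 - 'i%C * c4) =
       (b1 + q a * c1) + 'i%C * (b2 + q a * c2) - (b3 + q a * c3) - 'i%C * (b4 + q a * c4).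
      by rewrite -[LHS]add0r -g0; ring.
    apply: le_trans (le_cmodB _ _) _; apply: le_trans (lerD (le_cmodB _ _) (lexx _)) _.
    apply: le_trans (lerD (lerD (le_cmodD _ _) (lexx _)) (lexx _)) _.
    rewrite [cmod ('i%C * (b2 + _))]cmodM [cmod ('i%C * (b4 + _))]cmodM !cmodi !mul1r.
    apply: le_trans (lerD (lerD (lerD h1 h4) h2) h3) _.
    by rewrite le_eqVlt; apply/orP; left; apply/eqP; ring.
  move=> g5; have := le_trans g4 g5; rewrite ler_pM2l // => g6.
  by apply: le_trans g6 _; rewrite mulrA; lra.
apply/eqP; rewrite -cmod_eq0 eq_le cmod_ge0 andbT.
apply: contrapT => /negP; rewrite -ltNge => c0.
pose S := Num.max (8 * M / cmod (q a) + 1) (Num.max (2 * cmod a) (2 * `|r|)).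
have pos : 0 <= 8 * M / cmod (q a) by rewrite divr_ge0 ?mulr_ge0 // ltW.
have S1 : 8 * M / cmod (q a) + 1 <= S by rewrite /S le_max lexx.
have S0 : 0 < S by lra.
have := key S S0; rewrite /S !le_max !lexx !orbT -/S => /(_ isT isT).
rewrite ler_pdivlMr // => h.
have : 8 * M / cmod (q a) < S by lra.
rewrite ltr_pdivrMr //; lra.
Qed.

Lemma exists_notin E : exists x, x \notin E.
Proof.
pose s : seq C := [seq i%:R | i <- iota 0 (size E).+1].
have us : uniq s by rewrite map_inj_uniq ?iota_uniq // => i j /eqP; rewrite eqr_nat => /eqP.
have [/allP h|/allPn [x _ xE]] := boolP (all (mem E) s); last by exists x.
by have := uniq_leq_size us h; rewrite size_map size_iota ltnn.
Qed.

(* The induction enlarges [E], which is why points outside of it are exempted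
   although the theorem is applied with [E] empty. *)
Lemma polynomial_growth (N : nat) q E (M r : R) : continuous q ->
  (forall z, z \notin E -> cdiff_at q z) ->
  (forall z, r <= cmod z -> cmod (q z) <= M * cmod z ^+ N) ->
  exists2 p : {poly C}, (size p <= N.+1)%N & forall z, z \notin E -> q z = p.[z].
Proof.
(* Beyond r' the inequality |z| >= 2 |x| gives |z| <= 2 |z - x|, which is the factor 2 in [K], and
   |z| >= 1 absorbs the constant [cmod (q x)] into the power of |z|. *)
elim: N q E M r => [|N IHN] q E M r cq dq qM; have [x xE] := exists_notin E;
  have [phi [cphi dphi qphi]] := divided_slope cq dq xE;
  pose K := 2 * (M + cmod (q x)); pose r' := Num.max (Num.max 1 r) (2 * cmod x);
  have hr z : r' <= cmod z -> [/\ 1 <= cmod z, r <= cmod z & 2 * cmod x <= cmod z];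
  try by rewrite !ge_max => /andP[/andP[? ?] ?].
  have phiM z : r' <= cmod z -> cmod (phi z) * cmod z <= K.
    move=> /hr[z1 rz xz]; have zx : cmod z <= 2 * cmod (z - x).
      have := ge_cmodB z x; lra.
    apply: (@le_trans _ _ (2 * (cmod (phi z) * cmod (z - x)))).
      by rewrite mulrCA ler_wpM2l ?cmod_ge0.
    rewrite -cmodM /K ler_pM2l // (_ : phi z * _ = q z - q x); last by rewrite (qphi z); ring.
    by apply: le_trans (le_cmodB _ _) _; rewrite lerD2r; have := qM z rz; rewrite expr0 mulr1.
  exists (q x)%:P; first by rewrite size_polyC_leq1.
  move=> z zE; rewrite hornerC; have [->//|zx] := eqVneq z x.
  rewrite (qphi z) (@decay_eq0 phi (x :: E) z K r') ?mul0r ?addr0 //.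
  by rewrite inE negb_or zx.
have phiM z : r' <= cmod z -> cmod (phi z) <= K * cmod z ^+ N.
  move=> /hr[z1 rz xz]; have zx : cmod z <= 2 * cmod (z - x).
    have := ge_cmodB z x; lra.
  have z0 : 0 < cmod z by lra.
  rewrite -(ler_pM2r z0) -mulrA -exprSr.
  apply: (@le_trans _ _ (2 * (cmod (phi z) * cmod (z - x)))).
    by rewrite mulrCA ler_wpM2l ?cmod_ge0.
  rewrite -cmodM /K -mulrA ler_pM2l // (_ : phi z * _ = q z - q x); last by rewrite (qphi z); ring.
  apply: le_trans (le_cmodB _ _) _; rewrite mulrDl; apply: lerD; first exact: qM.
  by rewrite ler_peMr ?cmod_ge0 // exprn_ege1.
have [p sp hp] := IHN phi (x :: E) K r' cphi dphi phiM.
exists ((q x)%:P + ('X - x%:P) * p).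
  apply: leq_trans (size_polyD _ _) _; rewrite geq_max; apply/andP; split.
    by rewrite (leq_trans (size_polyC_leq1 _)).
  by apply: leq_trans (size_polyMleq _ _) _; rewrite size_XsubC.
move=> z zE; rewrite !hornerE; have [->|zx] := eqVneq z x.
  by rewrite subrr mul0r addr0.
by rewrite -hp ?inE ?negb_or ?zx // (qphi z) mulrC.
Qed.

End Liouville.

(** * Separately polynomial functions *)

Section MonomialExpansion.
Variables (K : numFieldType) (n D : nat).
Implicit Types (z : 'rV[K]_n) (j : 'I_n) (u : 'rV[K]_n -> K).
Implicit Types (al : {ffun 'I_n -> 'I_D}).

Definition upd z j (t : K) : 'rV[K]_n := \row_i (if i == j then t else z 0 i).

Definition mono z al : K := \prod_j z 0 j ^+ al j.

(** Starting at 1 keeps the grid, and any point with one coordinate moved to a node, off the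
    origin. *)
Definition node (a : 'I_D) : K := a.+1%:R.

Definition grid al : 'rV[K]_n := \row_j node (al j).

(** The premise says that the line through [z] in direction [j] misses the origin; the degree bound
    is common to all such lines. *)
Definition sep_poly u := forall z j, (exists2 i, i != j & z 0 i != 0) ->
  exists2 p : {poly K}, (size p <= D)%N & forall t, u (upd z j t) = p.[t].

Lemma upd_same z j : upd z j (z 0 j) = z.
Proof. by apply/rowP => i; rewrite mxE; case: eqP => // ->. Qed.

Lemma row_neq0P z : reflect (exists i, z 0 i != 0) (z != 0).
Proof.
apply: (iffP idP) => [z0|[i zi]]; last by apply: contraNneq zi => ->; rewrite mxE.
apply/existsP; apply: contraNT z0; rewrite negb_exists => /forallP z0.
by apply/eqP/rowP => i; rewrite mxE; apply/eqP; have := z0 i; rewrite negbK.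
Qed.

Lemma upd_neq0 z j t i : i != j -> z 0 i != 0 -> upd z j t != 0.
Proof. by move=> ij zi; apply/row_neq0P; exists i; rewrite mxE (negPf ij). Qed.

Lemma node_neq0 a : node a != 0. Proof. by rewrite pnatr_eq0. Qed.

Lemma node_inj : injective node.
Proof. by move=> a b /eqP; rewrite eqr_nat eqSS => /eqP /ord_inj. Qed.

Lemma poly_nodes_eq0 (p : {poly K}) : (size p <= D)%N ->
  (forall a, p.[node a] = 0) -> p = 0.
Proof.
move=> sp p0; apply: (@roots_geq_poly_eq0 _ p [seq node a | a <- enum 'I_D]).
- by apply/allP => _ /mapP [a _ ->]; apply/eqP; exact: p0.
- by rewrite map_inj_uniq ?enum_uniq //; exact: node_inj.
- by rewrite size_map size_enum_ord.
Qed.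

(** Coordinates are freed one by one: [P k] asks for nodes only from index [k] on, and a polynomial
    of degree < D vanishing at the D nodes is zero. *)
Lemma sep_poly_grid_eq0 u : (2 <= n)%N -> sep_poly u -> (forall al, u (grid al) = 0) ->
  forall z, z != 0 -> u z = 0.
Proof.
move=> n2 su u0.
pose P k := forall z, (forall j, (k <= j)%N -> exists a, z 0 j = node a) -> z != 0 -> u z = 0.
have P0 : P 0%N.
  move=> z hz _; have /fin_all_exists [a ha] : forall j, exists a, z 0 j = node a.
    by move=> j; exact: hz.
  rewrite (_ : z = grid [ffun j => a j]) //.
  by apply/rowP => j; rewrite mxE ffunE.
have PS k : (k < n)%N -> P k -> P k.+1.
  move=> kn Pk; pose j := Ordinal kn.
  have A z : (forall i : 'I_n, (k < i)%N -> exists a, z 0 i = node a) ->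
      (exists2 i, i != j & z 0 i != 0) -> u z = 0.
    move=> hz [i ij zi]; have [p sp pu] : exists2 p : {poly K},
        (size p <= D)%N & forall t, u (upd z j t) = p.[t] by apply: su; exists i.
    rewrite -(upd_same z j) pu (poly_nodes_eq0 sp) ?horner0 // => a; rewrite -pu.
    apply: Pk; last exact: upd_neq0 zi.
    move=> i'; rewrite mxE leq_eqVlt => /orP[/eqP ki|ki].
      by exists a; rewrite (_ : i' == j) //; apply/eqP/val_inj.
    by case: eqP => [_|_]; [exists a | exact: hz].
  move=> z hz z0.
  have [/existsP [i /andP [ij zi]]|no] := boolP [exists i, (i != j) && (z 0 i != 0)].
    by apply: A => //; exists i.
  (* Now [z] lies on the [j]-th axis, so its line in direction [j] runs through 0. Then [j] is the
     last index, as later coordinates would be nonzero nodes. The line in another direction [i]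
     misses 0, and its points with a node at [i] fall under [A]. *)
  have {}no i : i != j -> z 0 i = 0.
    move=> ij; apply/eqP; apply: contraNT no => zi; apply/existsP; exists i.
    by rewrite ij.
  have zj : z 0 j != 0.
    have /row_neq0P [i zi] := z0; have [<-//|ij] := eqVneq i j.
    by rewrite no ?eqxx in zi.
  have last (i : 'I_n) : ~~ (k < i)%N.
    apply/negP => ki; have [a ha] := hz i ki.
    have := node_neq0 a; rewrite -ha no ?eqxx //.
    by apply: contraTneq ki => ->; rewrite ltnn.
  have [i ij] : exists i : 'I_n, i != j.
    pose i0 := Ordinal (ltn_trans (ltnSn 0) n2); pose i1 := Ordinal n2.
    by have [<-|?] := eqVneq i0 j; [exists i1 | exists i0].
  have [p sp pu] : exists2 p : {poly K},
      (size p <= D)%N & forall t, u (upd z i t) = p.[t].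
    by apply: su; exists j => //; rewrite eq_sym.
  rewrite -(upd_same z i) pu (poly_nodes_eq0 sp) ?horner0 // => a; rewrite -pu.
  apply: A; first by move=> i' ki'; have := last i'; rewrite ki'.
  by exists i => //; rewrite mxE eqxx node_neq0.
have PA k : (k <= n)%N -> P k.
  by elim: k => [_|k IHk kn]; [exact: P0 | apply: PS => //; apply: IHk; exact: ltnW].
move=> z z0; apply: (PA n) => // j; by rewrite leqNgt ltn_ord.
Qed.

Definition vdm : 'M[K]_D := Vandermonde D (\row_a node a).

Lemma vdm_unit : vdm \in unitmx.
Proof.
rewrite unitmxE det_Vandermonde unitfE; apply/prodf_neq0 => i _.
apply/prodf_neq0 => j ij; rewrite !mxE subr_eq0; apply: contraTneq ij.
by move=> /node_inj ->; rewrite ltnn.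
Qed.

(* Coefficient of [z^al] in the polynomial interpolating [u] on the grid. *)
Definition grid_coef u al : K :=
  \sum_(a : {ffun 'I_n -> 'I_D}) u (grid a) * \prod_j invmx vdm (a j) (al j).

Lemma prod_delta (a b : {ffun 'I_n -> 'I_D}) :
  \prod_j ((a j == b j)%:R : K) = (a == b)%:R.
Proof.
have [->|ab] := eqVneq a b; first by rewrite big1 // => j _; rewrite eqxx.
have [j abj] : exists j, a j != b j.
  apply/existsP; apply: contraNT ab; rewrite negb_exists => /forallP h.
  by apply/eqP/ffunP => j; apply/eqP; have := h j; rewrite negbK.
by rewrite (bigD1 j) //= (negPf abj) mul0r.
Qed.

(** By distributivity the sum over exponents is a product of sums over one variable, each an entry
    of V^-1 V for the Vandermonde matrix V. The next lemma sums over grid points instead and meets V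
    V^-1. *)
Lemma grid_coef_interp u a :
  \sum_al grid_coef u al * mono (grid a) al = u (grid a).
Proof.
under eq_bigr do rewrite /grid_coef mulr_suml.
rewrite exchange_big /=.
under eq_bigr => b _ do [under eq_bigr do rewrite -mulrA; rewrite -mulr_sumr].
transitivity (\sum_b u (grid b) * ((b == a)%:R : K)); last first.
  by rewrite (bigD1 a) //= eqxx mulr1 big1 ?addr0 // => b /negPf ->; exact: mulr0.
apply: eq_bigr => b _; congr (_ * _).
under eq_bigr do rewrite /mono -big_split /=.
rewrite -(bigA_distr_bigA (fun j i => invmx vdm (b j) i * grid a 0 j ^+ i)) /=.
rewrite -prod_delta; apply: eq_bigr => j _.
have := congr1 (fun M : 'M_D => M (b j) (a j)) (mulVmx vdm_unit).
by rewrite !mxE => <-; apply: eq_bigr => i _; rewrite !mxE.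
Qed.

Lemma grid_coef_mono (c : {ffun 'I_n -> 'I_D} -> K) al :
  grid_coef (fun z => \sum_be c be * mono z be) al = c al.
Proof.
rewrite /grid_coef; under eq_bigr do rewrite mulr_suml.
rewrite exchange_big /=.
under eq_bigr => b _ do [under eq_bigr do rewrite -mulrA; rewrite -mulr_sumr].
transitivity (\sum_b c b * ((b == al)%:R : K)); last first.
  rewrite (bigD1 al) //= eqxx mulr1 big1 ?addr0 // => b /negPf ->; exact: mulr0.
apply: eq_bigr => b _; congr (_ * _).
under eq_bigr do rewrite /mono -big_split /=.
rewrite -prod_delta.
under eq_bigr => a _ do under eq_bigr => j _ do rewrite [grid a]/grid mxE.
rewrite -(bigA_distr_bigA (fun j i => node i ^+ b j * invmx vdm i (al j))) /=.
apply: eq_bigr => j _.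
have := congr1 (fun M : 'M_D => M (b j) (al j)) (mulmxV vdm_unit).
by rewrite !mxE => <-; apply: eq_bigr => i _; rewrite !mxE.
Qed.

Lemma grid_neq0 al : (0 < n)%N -> grid al != 0.
Proof. by move=> n0; apply/row_neq0P; exists (Ordinal n0); rewrite mxE node_neq0. Qed.

Lemma mono_coef_unique (c c' : {ffun 'I_n -> 'I_D} -> K) : (0 < n)%N ->
  (forall z, z != 0 -> \sum_be c be * mono z be = \sum_be c' be * mono z be) ->
  forall al, c al = c' al.
Proof.
move=> n0 h al; rewrite -(grid_coef_mono c) -(grid_coef_mono c').
by apply: eq_bigr => a _; rewrite h // grid_neq0.
Qed.

Lemma mono_upd z j t al :
  mono (upd z j t) al = t ^+ al j * \prod_(i | i != j) z 0 i ^+ al i.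
Proof.
rewrite /mono (bigD1 j) //= mxE eqxx; congr (_ * _).
by apply: eq_bigr => i ij; rewrite mxE (negPf ij).
Qed.

(** The difference of [u] and its interpolant is separately polynomial with the same degree bound
    and vanishes on the grid. *)
Lemma sep_polyP u : (2 <= n)%N -> sep_poly u ->
  exists c : {ffun 'I_n -> 'I_D} -> K,
    forall z, z != 0 -> u z = \sum_al c al * mono z al.
Proof.
move=> n2 su; exists (grid_coef u) => z z0; apply/eqP; rewrite -subr_eq0; apply/eqP.
move: z z0; apply: sep_poly_grid_eq0 => // [z j hz|a]; last first.
  by rewrite grid_coef_interp subrr.
have [p sp pu] := su z j hz.
exists (p - \sum_al (grid_coef u al * \prod_(i | i != j) z 0 i ^+ al i) *: 'X^(al j)).
  apply: leq_trans (size_polyD _ _) _; rewrite geq_max sp size_polyN /=.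
  apply: leq_trans (size_sum _ _ _) _; apply/bigmax_leqP => al _.
  by apply: leq_trans (size_scale_leq _ _) _; rewrite size_polyXn ltn_ord.
move=> t; rewrite !hornerE pu horner_sum; congr (_ - _); apply: eq_bigr => al _.
by rewrite !hornerE mono_upd mulrCA mulrA [_ * t ^+ _]mulrC mulrA.
Qed.

End MonomialExpansion.

(** * Eigenfunctions of a diagonal contraction *)

Section HopfEigenfunctions.
Variable R : realType.
Local Notation C := (Cplx R).

Lemma cmod_continuous : continuous (@cmod R : C -> R).
Proof.
move=> z; apply: (@cvgrPdist_lt _ R _ (nbhs z) _ _ _).2 => e e0; apply/(@nbhs_ballP _ C).
exists e%:C%C; first by rewrite /= ltcR.
move=> w; rewrite /ball /= normE_cmod ltcR; apply: le_lt_trans.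
rewrite ler_norml; apply/andP; split; last exact: ge_cmodB.
by rewrite lerNl opprB cmodBC ge_cmodB.
Qed.

(** A closed part of the image of the square [-1, 1]^2. The case a = 0 is the closed disc, in which
    the other coordinates of the shell range. *)
Lemma annulus_compact (a : R) : compact [set z : C | a <= cmod z <= 1]%classic.
Proof.
pose f (p : R * R) : C := cpt p.1 0 + cpt 0 p.2.
have cf : continuous f.
  move=> p; apply: (@continuousD C C _ (fun p : R * R => cpt p.1 0) (fun p : R * R => cpt 0 p.2)).
    exact: (@continuous_comp _ _ C (@fst R R) (fun t => cpt t 0) p
      (@cvg_fst _ _ _ _ _) (@cpt_continuousl R 0 _)).
  exact: (@continuous_comp _ _ C (@snd R R) (fun t => cpt 0 t) p
    (@cvg_snd _ _ _ _ _) (@cpt_continuousr R 0 _)).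
have cI := @segment_compact R (-1) 1.
have cS := @continuous_compact _ C f _ (continuous_subspaceT cf) (compact_setX cI cI).
apply: (subclosed_compact _ cS).
  rewrite (_ : mkset _ = (@cmod R @^-1` [set` `[a, 1]%R])%classic); last first.
    by apply/seteqP; split => z /=; rewrite in_itv.
  apply: preimage_closed; last exact: itv_closed.
  by move=> z _; exact: cmod_continuous.
move=> [x y] /= /andP[_ z1]; exists (x, y); last by rewrite /f /cpt /=; simpc.
have h1 := le_trans (Re_le_cmod _) z1; have h2 := le_trans (Im_le_cmod _) z1.
by split; rewrite /= in_itv /= -ler_norml.
Qed.

(** The shell is the union over j of the products of an annulus in coordinate j with closed discs in
    the others; each product is compact and misses 0. *)
Lemma shell_bounded n (g : 'rV[C]_n -> C) (a : R) : 0 < a ->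
  (forall z, z != 0 -> {for z, continuous g}) ->
  exists M : R, forall z : 'rV[C]_n, (forall j, cmod (z 0 j) <= 1) ->
    (exists j, a <= cmod (z 0 j)) -> cmod (g z) <= M.
Proof.
move=> a0 cg.
have /fin_all_exists [M hM] : forall j, exists M : R, forall z : 'rV[C]_n,
    (forall i, cmod (z 0 i) <= 1) -> a <= cmod (z 0 j) -> cmod (g z) <= M.
  move=> j; pose A i := if i == j then [set z : C | a <= cmod z <= 1]%classic
                        else [set z : C | 0 <= cmod z <= 1]%classic.
  pose K := [set v : 'rV[C]_n | forall i, A i (v ord0 i)]%classic.
  have cK : compact K.
    by apply: rV_compact => i; rewrite /A; case: eqP => _; exact: annulus_compact.
  have inK (z : 'rV[C]_n) : (forall i, cmod (z 0 i) <= 1) -> a <= cmod (z 0 j) -> K z.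
    by move=> z1 zj i; rewrite /A; case: eqP => [->|_] /=; rewrite ?zj ?cmod_ge0 z1.
  have [|K0] := pselect (K !=set0)%classic; last first.
    by exists 0 => z z1 zj; case: K0; exists z; exact: inK.
  move=> K0; have wc : {within K, continuous (fun z => cmod (g z))}%classic.
    apply: continuous_in_subspaceT => z; rewrite inE => Kz.
    apply: (@continuous_comp _ _ R g (@cmod R) z); last exact: cmod_continuous.
    apply: cg; apply: contraTneq a0 => z0; have := Kz j; rewrite /A eqxx /= z0 mxE cmod0.
    by move=> /andP[a0 _]; rewrite -leNgt.
  have [c _ hc] := compact_EVT_max K0 cK wc.
  by exists (cmod (g c)) => z z1 zj; apply: hc; rewrite inE; exact: inK.
exists (\sum_j `|M j|) => z z1 [j zj].
apply: le_trans (hM j z z1 zj) _; apply: le_trans (ler_norm _) _.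
by rewrite (bigD1 j) //= lerDl sumr_ge0.
Qed.

Section Multipliers.
Variables (n : nat) (mu : 'I_n -> C).
Hypothesis n2 : (2 <= n)%N.
Hypothesis hmu : forall i, 0 < `|mu i| /\ `|mu i| < 1.

Lemma cmod_mu i : 0 < cmod (mu i) < 1.
Proof. by have := hmu i; rewrite normE_cmod !ltcR => -[-> ->]. Qed.

Lemma mu_neq0 i : mu i != 0.
Proof. by rewrite -cmod_gt0; case/andP: (cmod_mu i). Qed.

Lemma prod_le_factor (x : 'I_n -> R) : (forall i, 0 < x i < 1) ->
  0 < \prod_i x i /\ forall j, \prod_i x i <= x j.
Proof.
move=> hx; split; first by apply: prodr_gt0 => i _; case/andP: (hx i).
move=> j; rewrite (bigD1 j) //= ler_piMr //; first by case/andP: (hx j) => /ltW.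
by apply: prodr_ile1 => i _; case/andP: (hx i) => /ltW -> /ltW ->.
Qed.

(** A product of numbers in ]0, 1[ lies below each factor: applied to the |mu_i| this gives [a], and
    applied to the 1 - |mu_i| it gives 1 - [rho]. *)
Lemma mu_bounds : exists a rho : R, [/\ 0 < a, 0 < rho, rho < 1 &
  forall i, a <= cmod (mu i) <= rho].
Proof.
have [p1 p2] := prod_le_factor cmod_mu.
have h i : 0 < 1 - cmod (mu i) < 1.
  by have /andP[? ?] := cmod_mu i; apply/andP; split; lra.
have [q1 q2] := prod_le_factor h.
exists (\prod_i cmod (mu i)), (1 - \prod_i (1 - cmod (mu i))).
pose i0 := Ordinal (ltnW n2).
split => //; last by move=> i; rewrite p2 lerBrDl -lerBrDr q2.
  by have := q2 i0; have /andP[? ?] := cmod_mu i0; lra.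
lra.
Qed.

Lemma iter_hopf m z j : (iter m (hopf_map mu) z) 0 j = mu j ^+ m * z 0 j.
Proof.
elim: m => [|m IHm]; first by rewrite expr0 mul1r.
by rewrite iterS /hopf_map mxE IHm exprS mulrA.
Qed.

Lemma iter_hopf_neq0 m z : (iter m (hopf_map mu) z != 0) = (z != 0).
Proof.
apply/row_neq0P/row_neq0P; case=> i; rewrite ?iter_hopf => hi; exists i.
  by apply: contraNneq hi => ->; rewrite mulr0.
by rewrite iter_hopf mulf_neq0 // expf_neq0 // mu_neq0.
Qed.

Lemma expr_small (rho e : R) : 0 < rho -> rho < 1 -> 0 < e -> exists N, rho ^+ N <= e.
Proof.
move=> r0 r1 e0; have : (GRing.exp rho @ \oo --> (0 : R))%classic.
  by apply: cvg_expr; rewrite ger0_norm // ltW.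
move=> /(@cvgrPdist_lt _ R) /(_ e e0) [N _ hN]; exists N.
have := hN N (leqnn N).
by rewrite /= sub0r normrN ger0_norm ?exprn_ge0 ?(ltW r0) // => /ltW.
Qed.

Variables (g : 'rV[C]_n -> C) (lam : C).
Hypothesis lam0 : lam != 0.
Hypothesis dg : forall z, z != 0 -> differentiable (g : 'rV[C]_n -> C) z.
Hypothesis eqg : forall z, z != 0 -> g (hopf_map mu z) = lam * g z.

Lemma eigen_iter m z : z != 0 -> g (iter m (hopf_map mu) z) = lam ^+ m * g z.
Proof.
move=> z0; elim: m => [|m IHm]; first by rewrite expr0 mul1r.
by rewrite iterS eqg ?iter_hopf_neq0 // IHm exprS mulrA.
Qed.

(* The orbit of [w] meets the compact shell [{|z_j| <= 1, max |z_j| >= a}] after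
   about [log |w|] steps. *)
Lemma eigen_growth : exists N (M : R), forall (w : 'rV[C]_n) (X : R),
  (exists j, 1 <= cmod (w 0 j)) -> (forall j, cmod (w 0 j) <= X) ->
  cmod (g w) <= M * X ^+ N.
Proof.
have [a [rho [a0 r0 r1 har]]] := mu_bounds.
have cg z : z != 0 -> {for z, continuous g}.
  by move=> z0; exact: (differentiable_continuous (dg z0)).
have [M hM] := shell_bounded a0 cg.
have l0 : 0 < cmod lam by rewrite cmod_gt0.
(* [N] becomes the degree: it compares the contraction of [w] with the factor [lam] that each step
   brings to [g]. *)
have [N hN] := expr_small r0 r1 l0.
have rN0 : 0 < rho ^+ N by rewrite exprn_gt0.
exists N, (`|M| / rho ^+ N) => w X [j wj] wX.
have X1 : 1 <= X by apply: le_trans wj (wX j).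
have X0 : 0 < X by apply: lt_le_trans X1.
have w0 : w != 0.
  by apply/row_neq0P; exists j; rewrite -cmod_gt0; apply: lt_le_trans wj.
have step i m : cmod (mu i ^+ m * w 0 i) <= rho ^+ m * X.
  rewrite cmodM cmodX ler_pM ?exprn_ge0 ?cmod_ge0 //.
  by rewrite lerXn2r ?nnegrE ?cmod_ge0 ?(ltW r0) //; case/andP: (har i).
pose P m := [forall i, cmod (mu i ^+ m * w 0 i) <= 1].
have exP : exists m, P m.
  have [|m hm] := @expr_small rho X^-1 r0 r1; first by rewrite invr_gt0.
  exists m; apply/forallP => i; apply: le_trans (step i m) _.
  by rewrite -ler_pdivlMr // div1r.
have iterM m : P m -> (exists i, a <= cmod (mu i ^+ m * w 0 i)) ->
    cmod lam ^+ m * cmod (g w) <= `|M|.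
  move=> /forallP Pm [i ai]; rewrite -cmodX -cmodM -eigen_iter //.
  apply: le_trans (ler_norm _); apply: hM => [i'|]; first by rewrite iter_hopf.
  by exists i; rewrite iter_hopf.
(* The first iterate in the unit polydisc lies in the shell: either it is [w] itself, which has a
   coordinate of modulus at least 1, or one step earlier some coordinate exceeded 1 and the step
   multiplied its modulus by at least [a]. In the second case that coordinate also gives rho^m X >=
   1. *)
case: (ex_minnP exP) => [[|m]] Pm minm.
  have h : cmod (g w) <= `|M|.
    have := iterM 0%N Pm; rewrite expr0 mul1r; apply; exists j; rewrite expr0 mul1r.
    apply: le_trans wj; have /andP[aj _] := har j; apply: le_trans aj _.
    by case/andP: (cmod_mu j) => _ /ltW.
  apply: le_trans h _; rewrite -mulrA ler_peMr // mulrC ler_pdivlMr // mul1r.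
  apply: (@le_trans _ _ 1); first by rewrite exprn_ile1 // ltW.
  by rewrite exprn_ege1.
have [i hi] : exists i, 1 < cmod (mu i ^+ m * w 0 i).
  apply/existsP; apply: contraT; rewrite negb_exists => /forallP h.
  have : P m by apply/forallP => i; have := h i; rewrite -leNgt.
  by move/minm; rewrite ltnn.
have rX : 1 <= rho ^+ m * X by apply/ltW/(lt_le_trans hi).
have hlam : cmod lam ^+ m.+1 * cmod (g w) <= `|M|.
  apply: iterM => //.
  exists i; rewrite exprS -mulrA cmodM -[a]mulr1 ler_pM // ?(ltW a0) ?(ltW hi) //.
  by case/andP: (har i).
rewrite mulrAC ler_pdivlMr // mulrC.
apply: le_trans (ler_wpM2r (exprn_ge0 N (ltW X0)) hlam); rewrite mulrAC.
rewrite ler_wpM2r ?cmod_ge0 //.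
(* rho^(N (m+1)) X^N = rho^N (rho^m X)^N >= rho^N: the one step beyond [m] accounts for the division
   by rho^N in the constant. *)
apply: (@le_trans _ _ ((rho ^+ N) ^+ m.+1 * X ^+ N)); last first.
  rewrite ler_wpM2r ?exprn_ge0 ?(ltW X0) //.
  by rewrite lerXn2r ?nnegrE ?(ltW rN0) ?(ltW l0).
by rewrite exprS -mulrA ler_peMr ?(ltW rN0) // exprAC -exprMn exprn_ege1.
Qed.

End Multipliers.
End HopfEigenfunctions.

Section EigenfunctionExpansion.
Variable R : realType.
Local Notation C := (Cplx R).

Lemma differentiable_cdiff (h : C -> C) t : differentiable h t -> cdiff_at h t.
Proof.
move=> dh; have dv : derivable h t 1 by exact: diff_derivable.
pose L := 'D_1 h t.
pose phi w := if w == t then L else (h w - h t) / (w - t).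
exists phi; last first.
  move=> w; rewrite /phi; case: eqVneq => [->|wt]; first by rewrite subrr mulr0 addr0.
  by rewrite divfK ?subr_eq0 // [RHS]addrC subrK.
apply/continuousP_cmod => e e0; rewrite {2}/phi eqxx.
have := (@cvgrPdist_lt _ C _ _ _ _ _).1 dv e%:C%C.
rewrite ltcR => /(_ (dnbhs_filter _) e0) /(@nbhs_ballP _ _) [d /= d0 dF].
have dE : d = (complex.Re d)%:C%C by rewrite RRe_real // gtr0_real.
exists (complex.Re d); first by move: d0; rewrite dE ltcR.
move=> w wt; rewrite /phi; case: eqVneq => [_|wt0]; first by rewrite subrr cmod0.
have := dF (w - t); rewrite /ball /= sub0r normrN dE normE_cmod ltcR => /(_ wt).
rewrite subr_eq0 => /(_ wt0).
rewrite distrC normE_cmod ltcR.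
have -> : (w - t)^-1 *: (h ((w - t)%:A + t) - h t) = (h w - h t) / (w - t).
  by rewrite [_%:A]mulr1 subrK; exact: mulrC.
exact.
Qed.

Section Line.
Variables (n : nat) (z : 'rV[C]_n) (j : 'I_n).

Lemma updE t : upd z j t = upd z j 0 + t *: delta_mx 0 j.
Proof.
apply/rowP => i; rewrite !mxE; case: eqVneq => _; first by rewrite mulr1 add0r.
by rewrite mulr0 addr0.
Qed.

Lemma upd_differentiable (t : C) : differentiable (fun t : C => upd z j t) t.
Proof.
rewrite (_ : (fun t => _) = (fun t : C => upd z j 0 + t *: (delta_mx 0 j : 'rV[C]_n))); last first.
  by apply/funext => t'; exact: updE.
apply: differentiableD; first exact: differentiable_cst.
by apply: differentiableZl; exact: ex_diff.
Qed.

End Line.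

Lemma eigen_expansion n (mu : 'I_n -> C) (g : 'rV[C]_n -> C) (lam : C) : (2 <= n)%N ->
  (forall i, 0 < `|mu i| /\ `|mu i| < 1) -> lam != 0 ->
  (forall z, z != 0 -> differentiable (g : 'rV[C]_n -> C) z) ->
  (forall z, z != 0 -> g (hopf_map mu z) = lam * g z) ->
  exists D (c : {ffun 'I_n -> 'I_D} -> C),
    (forall z, z != 0 -> g z = \sum_al c al * mono z al) /\
    (forall al, c al != 0 -> \prod_j mu j ^+ al j = lam).
Proof.
move=> n2 hmu lam0 dg eqg.
have [N [M hM]] := eigen_growth n2 hmu lam0 dg eqg.
have su : sep_poly N.+1 g.
  move=> z j [i ij zi].
  have dh t : differentiable (fun t : C => g (upd z j t)) t.
    apply: (@differentiable_comp _ _ _ _ (fun t : C => upd z j t) g);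
      first exact: upd_differentiable.
    by apply: dg; apply: upd_neq0 zi.
  (* Beyond this radius |t| is at least 1 and dominates the other coordinates, so [hM] applies with
     X = |t|, with an [N] that is independent of the line. *)
  have [|p sp hp] := @polynomial_growth R N (fun t => g (upd z j t)) [::] M
     (1 + \sum_i cmod (z 0 i)) (fun t => differentiable_continuous (dh t))
     (fun t _ => differentiable_cdiff (dh t)); last by exists p => // t; exact: hp.
  move=> t ht; have s0 : 0 <= \sum_i cmod (z 0 i) by apply: sumr_ge0 => *; exact: cmod_ge0.
  apply: hM; first by exists j; rewrite mxE eqxx; lra.
  move=> i'; rewrite mxE; case: eqP => // _; apply: le_trans ht.
  have h0 : 0 <= \sum_(k | k != i') cmod (z 0 k) by apply: sumr_ge0 => *; exact: cmod_ge0.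
  by rewrite (bigD1 i') //=; lra.
have [c hc] := sep_polyP n2 su; exists N.+1, c; split => // al cal.
have E : c al * \prod_j mu j ^+ al j = lam * c al.
  apply: (@mono_coef_unique C n N.+1 (fun al => c al * \prod_j mu j ^+ al j)
    (fun al => lam * c al) (ltnW n2)).
  move=> z z0; have fz0 : hopf_map mu z != 0.
    by have := iter_hopf_neq0 hmu 1 z; rewrite /= z0.
  transitivity (g (hopf_map mu z)); last first.
    by rewrite eqg // hc // mulr_sumr; apply: eq_bigr => be _; rewrite mulrA.
  rewrite hc //; apply: eq_bigr => be _; rewrite -mulrA; congr (_ * _).
  by rewrite /mono -big_split /=; apply: eq_bigr => j _; rewrite mxE exprMn.
by apply: (mulfI cal); rewrite [RHS]mulrC.
Qed.

End EigenfunctionExpansion.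

(** * Alternating forms *)

Section AlternatingForms.
Variables (R : realType) (n k : nat).
Local Notation C := (Cplx R).
Implicit Types (V : 'M[C]_(k, n)) (w : 'rV[C]_n) (a c : 'I_k) (i : {ffun 'I_k -> 'I_n}).

Definition basis_frame i : 'M[C]_(k, n) := \matrix_(a, j) (j == i a)%:R.

Definition set_row V a w : 'M[C]_(k, n) :=
  \matrix_(a', j) (if a' == a then w 0 j else V a' j).

Lemma row_set_row V a w : row a (set_row V a w) = w.
Proof. by apply/rowP => j; rewrite !mxE eqxx. Qed.

Lemma row_set_row_neq V a a' w : a' != a -> row a' (set_row V a w) = row a' V.
Proof. by move=> /negPf h; apply/rowP => j; rewrite !mxE h. Qed.

Lemma row'_set_row V a w : row' a (set_row V a w) = row' a V.
Proof. by apply/matrixP => b j; rewrite !mxE eq_sym (negPf (neq_lift _ _)). Qed.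

Lemma set_row_id V a : set_row V a (row a V) = V.
Proof. by apply/matrixP => b j; rewrite !mxE; case: eqP => [->|]. Qed.

Section Form.
Variable eta : 'M[C]_(k, n) -> C.
Hypothesis eta_alt : alternating_multilinear eta.

Lemma form_linear V a w1 w2 (c1 c2 : C) :
  eta (set_row V a (c1 *: w1 + c2 *: w2)) =
  c1 * eta (set_row V a w1) + c2 * eta (set_row V a w2).
Proof. by apply: (eta_alt.1 _ _ _ a); rewrite ?row_set_row ?row'_set_row. Qed.

Lemma form_add V a w1 w2 :
  eta (set_row V a (w1 + w2)) = eta (set_row V a w1) + eta (set_row V a w2).
Proof. by have := form_linear V a w1 w2 1 1; rewrite !scale1r !mul1r. Qed.

Lemma form_sum V a (I : Type) (s : seq I) (x : I -> C) (f : I -> 'rV[C]_n) :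
  eta (set_row V a (\sum_(j <- s) x j *: f j)) =
  \sum_(j <- s) x j * eta (set_row V a (f j)).
Proof.
elim: s => [|j s IHs]; last first.
  rewrite !big_cons -IHs.
  have := form_linear V a (f j) (\sum_(j <- s) x j *: f j) (x j) 1.
  by rewrite scale1r mul1r.
have := form_linear V a 0 0 0 0; rewrite !big_nil !scale0r add0r => ->.
by rewrite !mul0r addr0.
Qed.

Lemma form_expand_row V a :
  eta V = \sum_j V a j * eta (set_row V a (delta_mx 0 j)).
Proof.
rewrite -{1}(set_row_id V a) {1}(row_sum_delta (row a V)) form_sum.
by apply: eq_bigr => j _; rewrite mxE.
Qed.

(** Polarization: expand the zero value taken when x + y stands in both rows. *)
Lemma form_swap V a c : a != c ->
  eta (set_row (set_row V a (row c V)) c (row a V)) = - eta V.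
Proof.
move=> ac; pose S x y := eta (set_row (set_row V a x) c y).
have Sxx x : S x x = 0.
  by apply: (eta_alt.2 _ a c ac); rewrite row_set_row row_set_row_neq // row_set_row.
have Sl x x' y : S (x + x') y = S x y + S x' y.
  have com u v : set_row (set_row V a u) c v = set_row (set_row V c v) a u.
    apply/matrixP => b j; rewrite !mxE; case: (eqVneq b c) => // ->.
    by rewrite eq_sym (negPf ac).
  by rewrite /S !com form_add.
have Sr x y y' : S x (y + y') = S x y + S x y' by exact: form_add.
have := Sxx (row a V + row c V); rewrite Sl !Sr !Sxx add0r addr0 => /eqP.
rewrite addrC addr_eq0 => /eqP; rewrite /S => ->; congr (- eta _).
by rewrite set_row_id; exact: set_row_id.
Qed.

Lemma form_eq0 : (forall i, eta (basis_frame i) = 0) -> forall V, eta V = 0.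
Proof.
move=> e0; pose P t := forall V,
  (forall a, (t <= a)%N -> exists j, row a V = delta_mx 0 j) -> eta V = 0.
suff PA t : (t <= k)%N -> P t.
  by move=> V; apply: (PA k) => // a; rewrite leqNgt ltn_ord.
elim: t => [_|t IHt tk] V hV.
  have /fin_all_exists [i hi] : forall a, exists j, row a V = delta_mx 0 j.
    by move=> a; exact: hV.
  rewrite (_ : V = basis_frame [ffun a => i a]) //.
  by apply/row_matrixP => a; rewrite hi; apply/rowP => j; rewrite !mxE ffunE.
pose a := Ordinal tk; rewrite (form_expand_row V a) big1 // => j _.
rewrite (IHt (ltnW tk)) ?mulr0 // => a'; rewrite leq_eqVlt => /orP[/eqP ta|ta].
  have -> : a' = a by exact/val_inj.
  by exists j; rewrite row_set_row.
rewrite row_set_row_neq; first exact: hV.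
by apply: contraTneq ta => ->; rewrite ltnn.
Qed.

(* Exchanging the values at an inversion of [i] raises [\sum_a a * i a]. *)
Lemma form_increasing_eq0 : (forall i, increasing i -> eta (basis_frame i) = 0) ->
  forall V, eta V = 0.
Proof.
move=> e0; apply: form_eq0 => i.
pose wt (i : {ffun 'I_k -> 'I_n}) := (\sum_(a < k) a * i a)%N.
have wt_max (i' : {ffun 'I_k -> 'I_n}) : (wt i' <= \sum_(a < k) k * n)%N.
  by apply: leq_sum => a _; apply: leq_mul; exact: ltnW.
have [d] := ubnP (\sum_(a < k) k * n - wt i)%N.
elim: d i => // d IHd i hd.
have [/e0 //|] := boolP (increasing i).
rewrite negb_forall => /existsP [a]; rewrite negb_forall => /existsP [c].
rewrite negb_imply -leqNgt => /andP [ac ica].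
have anc : a != c by rewrite -val_eqE ltn_eqF.
have [icae|icae] := eqVneq (i c) (i a).
  by apply: (eta_alt.2 _ a c anc); apply/rowP => j; rewrite !mxE icae.
have lt_ca : (i c < i a)%N by rewrite ltn_neqAle ica andbT val_eqE.
pose i' := [ffun x => i (tperm a c x)].
have i'E : basis_frame i' =
    set_row (set_row (basis_frame i) a (row c (basis_frame i))) c (row a (basis_frame i)).
  apply/matrixP => x j; rewrite !mxE ffunE.
  by case: tpermP => [->|->|/eqP/negPf -> /eqP/negPf ->]; rewrite ?eqxx // (negPf anc).
have := form_swap (basis_frame i) anc; rewrite -i'E => /eqP.
rewrite -eqr_oppLR => /eqP <-; rewrite IHd ?oppr0 //.
have wlt : (wt i < wt i')%N.
  have wtE f : wt f = (a * f a + (c * f c + \sum_(x < k | (x != a) && (x != c)) x * f x))%N.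
    by rewrite /wt (bigD1 a) //= (bigD1 c) //= eq_sym.
  rewrite !wtE !ffunE tpermL tpermR !addnA.
  rewrite [X in (_ < _ + X)%N](eq_bigr (fun x : 'I_k => (x * i x)%N)).
    rewrite ltn_add2r; move: ac lt_ca.
    by move: (nat_of_ord a) (nat_of_ord c) (nat_of_ord (i a)) (nat_of_ord (i c)) => A B X Y; nia.
  by move=> x /andP[xa xc]; rewrite ffunE tpermD // eq_sym.
apply: leq_trans (_ : \sum_(a < k) k * n - wt i <= d)%N => //.
by apply: ltn_sub2l => //; apply: leq_trans wlt (wt_max _).
Qed.

End Form.

Lemma increasing_inj i : increasing i -> injective i.
Proof.
move=> /forallP hi a c eac; have hac := forallP (hi a) c; have hca := forallP (hi c) a.
apply/val_inj; case: (ltngtP a c) => // lt.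
  by move/implyP: hac => /(_ lt); rewrite eac ltnn.
by move/implyP: hca => /(_ lt); rewrite eac ltnn.
Qed.

(** An increasing tuple is the sorted list of its values; one inclusion is enough since both lists
    have [k] distinct entries. *)
Lemma increasing_codom_eq i i' : increasing i -> increasing i' ->
  {subset codom i' <= codom i} -> i' = i.
Proof.
move=> ii ii' sub.
pose s (f : {ffun 'I_k -> 'I_n}) := [seq val (f a) | a <- enum 'I_k].
have ss f : increasing f -> sorted ltn (s f).
  move=> hf; rewrite /s sorted_map.
  have : sorted (relpre val ltn) (enum 'I_k) by rewrite -sorted_map val_enum_ord iota_ltn_sorted.
  by apply: sub_sorted => a c /=; move/forallP: hf => /(_ a)/forallP/(_ c)/implyP.
have us f : increasing f -> uniq (s f).
  by move=> /ss; apply: sorted_uniq; [exact: ltn_trans | exact: ltnn].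
have sz f : size (s f) = k by rewrite size_map size_enum_ord.
have subs : {subset s i' <= s i}.
  move=> _ /mapP [a _ ->]; have /codomP [c ->] := sub _ (codom_f i' a).
  by apply: map_f; rewrite mem_enum.
have [|_ e] := uniq_min_size (us _ ii') subs; first by rewrite !sz.
have : s i' = s i.
  by apply: (irr_sorted_eq ltn_trans ltnn); [exact: ss | exact: ss | exact: e].
move=> es; apply/ffunP => a; apply: val_inj.
have /eq_in_map/(_ a) := es; apply; exact: mem_enum.
Qed.

(** For distinct tuples some value of [i'] is missing from [i], and the minor has a zero row. *)
Lemma wedge_basis_frame i i' : increasing i -> increasing i' ->
  wedge_dz i (basis_frame i') = (i == i')%:R.
Proof.
move=> ii ii'; have [<-|ni] := eqVneq i i'.
  rewrite /wedge_dz (_ : colsub i _ = 1%:M) ?det1 //.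
  by apply/matrixP => a c; rewrite !mxE (inj_eq (increasing_inj ii)) eq_sym.
have [a ha] : exists a, i' a \notin codom i.
  apply/existsP; apply: contraNT ni; rewrite negb_exists => /forallP h.
  apply/eqP/esym/increasing_codom_eq => // _ /codomP [a ->].
  by have := h a; rewrite negbK.
rewrite /wedge_dz (expand_det_row _ a) big1 // => c _.
rewrite !mxE (_ : (i c == i' a) = false) ?mul0r //.
by apply: contraNF ha => /eqP <-; exact: codom_f.
Qed.

Lemma wedge_alternating i : alternating_multilinear (@wedge_dz R n k i).
Proof.
split=> [V V1 V2 a c1 c2 hr h1 h2 | V a1 a2 a12 hr].
  apply: (@determinant_multilinear _ _ _ _ _ a).
  - by apply/rowP => j; have /rowP/(_ (i j)) := hr; rewrite !mxE.
  - by apply/matrixP => x j; have /matrixP/(_ x (i j)) := h1; rewrite !mxE.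
  - by apply/matrixP => x j; have /matrixP/(_ x (i j)) := h2; rewrite !mxE.
apply: (determinant_alternate a12) => j.
by have /rowP/(_ (i j)) := hr; rewrite !mxE.
Qed.

(** The difference of the two sides is alternating and, by duality, vanishes on increasing basis
    frames. *)
Lemma form_expansion (eta : 'M[C]_(k, n) -> C) : alternating_multilinear eta ->
  forall V, eta V = \sum_(i | increasing i) eta (basis_frame i) * wedge_dz i V.
Proof.
move=> alt V; apply/eqP; rewrite -subr_eq0; apply/eqP.
pose D V := eta V - \sum_(i | increasing i) eta (basis_frame i) * wedge_dz i V.
apply: (form_increasing_eq0 (eta := D)); rewrite /D.
  split=> [V0 V1 V2 a c1 c2 hr h1 h2 | V0 a1 a2 a12 hr].
    rewrite [X in _ - X](_ : _ =
      c1 * (\sum_(i | increasing i) eta (basis_frame i) * wedge_dz i V1) +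
      c2 * (\sum_(i | increasing i) eta (basis_frame i) * wedge_dz i V2)).
      by rewrite (alt.1 V0 V1 V2 a c1 c2) //; ring.
    rewrite !mulr_sumr -big_split /=; apply: eq_bigr => i _.
    by rewrite ((wedge_alternating i).1 V0 V1 V2 a c1 c2) //; ring.
  rewrite (alt.2 _ _ _ a12 hr) big1 ?subrr // => i _.
  by rewrite ((wedge_alternating i).2 _ _ _ a12 hr) mulr0.
move=> i ii; rewrite (bigD1 i) //= wedge_basis_frame // eqxx mulr1 big1 ?addr0 ?subrr //.
by move=> i' /andP[ii' /negPf ni]; rewrite wedge_basis_frame // ni mulr0.
Qed.

Lemma form_scale (eta : 'M[C]_(k, n) -> C) (d : 'rV[C]_k) V :
  alternating_multilinear eta ->
  eta (diag_mx d *m V) = \prod_a d 0 a * eta V.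
Proof.
move=> alt; rewrite !(form_expansion alt) mulr_sumr; apply: eq_bigr => i _.
rewrite /wedge_dz (_ : colsub i _ = diag_mx d *m colsub i V); last first.
  by apply/matrixP => a c; rewrite !mxE; apply: eq_bigr => x _; rewrite !mxE.
by rewrite det_mulmx det_diag mulrCA.
Qed.

End AlternatingForms.

(** * Forms on Hopf manifolds *)

Section OrbitSpaces.
Variables (T : Type) (S : set T) (F : T -> T).
Hypothesis F_inj : injective F.

Lemma zorbit_step x : zorbit F (F x) = zorbit F x.
Proof.
apply/seteqP; split => y [m []] h.
- by exists m.+1; left; rewrite iterSr.
- case: m h => [|m] /= h; first by exists 1%N; left.
  by exists m; right; exact: F_inj.
- case: m h => [|m] /= h; first by exists 1%N; right; rewrite /= h.
  by exists m; left; rewrite -iterSr.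
- by exists m.+1; right; rewrite /= h.
Qed.

Lemma orb_eqP x y (hx : S x) (hy : S y) :
  orb F hx = orb F hy <-> zorbit F x = zorbit F y.
Proof. by split=> [[]|h] //; exact: eq_exist. Qed.

Lemma orb_step x (hx : S x) (hFx : S (F x)) : orb F hFx = orb F hx.
Proof. by apply/orb_eqP; exact: zorbit_step. Qed.

Lemma orb_eq_iter x y (hx : S x) (hy : S y) : orb F hx = orb F hy ->
  exists m, iter m F x = y \/ iter m F y = x.
Proof.
move=> /orb_eqP e; suff : zorbit F x y by [].
by rewrite e; exists 0%N; left.
Qed.

End OrbitSpaces.

Section HopfQuotient.
Variables (R : realType) (n : nat) (mu : 'I_n -> Cplx R).
Local Notation C := (Cplx R).
Hypothesis hmu : forall i, 0 < `|mu i| /\ `|mu i| < 1.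

Let f := hopf_map mu.

Lemma hopf_mapE : f = mulmxr (diag_mx (\row_j mu j)).
Proof.
apply/funext => z; apply/rowP => j; rewrite /= mul_mx_diag !mxE; exact: mulrC.
Qed.

Lemma mulmxr_differentiable p (A : 'M[C]_(n, p)) (z : 'rV[C]_n) :
  differentiable (mulmxr A : 'rV[C]_n -> 'rV[C]_p) z.
Proof.
rewrite (_ : (mulmxr A : 'rV[C]_n -> 'rV[C]_p) =
  \sum_(j < n) ((fun z : 'rV[C]_n => z 0 j *: row j A) : 'rV[C]_n -> 'rV[C]_p)).
  apply: differentiable_sum => j; apply: differentiableZl; exact: differentiable_coord.
by apply/funext => w; rewrite fct_sumE /= mulmx_sum_row.
Qed.

Lemma diff_mulmxr p (A : 'M[C]_(n, p)) (z : 'rV[C]_n) :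
  'd (mulmxr A : 'rV[C]_n -> 'rV[C]_p) z = mulmxr A :> ('rV[C]_n -> 'rV[C]_p).
Proof.
apply: diff_lin => w; apply: differentiable_continuous; exact: mulmxr_differentiable.
Qed.

Lemma tangent_hopf k z (V : 'M[C]_(k, n)) :
  tangent_map f z V = V *m diag_mx (\row_j mu j).
Proof.
apply/row_matrixP => a; rewrite rowK hopf_mapE diff_mulmxr /= row_mul.
by [].
Qed.

Lemma diag_mu_inj k : injective (fun V : 'M[C]_(k, n) => V *m diag_mx (\row_j mu j)).
Proof.
move=> V W /matrixP e; apply/matrixP => a j; have := e a j.
by rewrite !mul_mx_diag !mxE => /(mulIf (mu_neq0 hmu j)).
Qed.

Lemma hopf_map_inj : injective f.
Proof. by rewrite hopf_mapE; exact: diag_mu_inj. Qed.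

(** Freeness of the action: a nonzero coordinate gives mu_j^m = 1 although |mu_j| < 1. *)
Lemma iter_hopf_fixed m (z : 'rV[C]_n) : z != 0 -> iter m f z = z -> m = 0%N.
Proof.
move=> /row_neq0P [j zj] /rowP/(_ j); rewrite iter_hopf => /eqP.
rewrite -{2}[z 0 j]mul1r (inj_eq (mulIf zj)) => /eqP mu1.
have := congr1 (@cmod R) mu1; rewrite cmodX cmod1 => e.
apply/eqP; apply: contraT => m0.
have /andP[c0 c1] := cmod_mu hmu j.
have : cmod (mu j) ^+ m < 1 by rewrite exprn_ilt1 // ltW.
by rewrite e ltxx.
Qed.

Section Bundle.
Variables (b : C) (k : nat) (omega : hopf_frames mu k -> hopf_line_bundle mu b).
Hypothesis hb : b != 0.

Let fb (p : 'rV[C]_n * C) := (f p.1, b * p.2).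

Lemma fb_inj : injective fb.
Proof. by move=> [z u] [w v] [/hopf_map_inj -> /(mulfI hb) ->]. Qed.

Lemma iter_fb m p : (iter m fb p).1 = iter m f p.1.
Proof. by elim: m => //= m ->. Qed.

(** By freeness two points of one orbit over the same [z] are zero steps apart; thus an equation in
    the line bundle becomes one between numbers. *)
Lemma orb_line_inj (z : 'rV[C]_n) (hz : z != 0) (u v : C) :
  @orb _ [set p | p.1 != 0]%classic fb (z, u) hz = @orb _ [set p | p.1 != 0]%classic fb (z, v) hz ->
  u = v.
Proof.
move=> h; have [m [] e] := orb_eq_iter h; have := congr1 fst e;
  rewrite iter_fb /= => /(iter_hopf_fixed hz) m0;
  by move: e; rewrite m0 /= => -[].
Qed.

Lemma pullback_unique (theta theta' : 'rV[C]_n -> 'M[C]_(k, n) -> C) :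
  is_pullback omega theta -> is_pullback omega theta' ->
  forall z V, z != 0 -> theta z V = theta' z V.
Proof.
move=> h h' z V hz; apply: (@orb_line_inj z hz).
by rewrite -[LHS](h z hz V) -[RHS](h' z hz V).
Qed.

Variable theta : 'rV[C]_n -> 'M[C]_(k, n) -> C.
Hypothesis hth : is_pullback omega theta.

(** (z, V) and (f z, df V) are the same frame of X, and (z, v) and (f z, b v) the same vector of
    L_b; reading omega over f z in both ways produces the twist [b]. *)
Lemma pullback_equivariant z V : z != 0 ->
  theta (f z) (V *m diag_mx (\row_j mu j)) = b * theta z V.
Proof.
move=> hz; have hfz : f z != 0 by have := iter_hopf_neq0 hmu 1 z; rewrite /= hz.
apply: (@orb_line_inj _ hfz).
pose F (p : 'rV[C]_n * 'M[C]_(k, n)) := (hopf_map mu p.1, tangent_map (hopf_map mu) p.1 p.2).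
have F_inj : injective F.
  move=> [z1 V1] [z2 V2] []; rewrite !tangent_hopf => /hopf_map_inj -> h.
  by congr (_, _); exact: diag_mu_inj h.
have := hth hfz (V *m diag_mx (\row_j mu j)); rewrite -/F => <-.
have e1 := @orb_step _ [set p | p.1 != 0]%classic F F_inj (z, V) hz hfz.
have e2 := @orb_step _ [set p | p.1 != 0]%classic fb fb_inj (z, theta z V) hz hfz.
have := hth hz V; rewrite -/F -e1 -[RHS]e2 => <-; congr (omega _).
by apply/orb_eqP; rewrite /F /= tangent_hopf.
Qed.

End Bundle.
End HopfQuotient.

(** * Exponents determined by the multipliers *)

Section Exponents.
Variables (R : realType) (n : nat) (mu : 'I_n -> Cplx R).
Local Notation C := (Cplx R).
Hypothesis mu0 : forall i, mu i != 0.

(** Cancelling the common factor with exponents min(be, be') leaves a relation with exponents |be -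
    be'| between two disjoint index sets, according to which exponent is larger. *)
Lemma no_relation_unique (S : {set 'I_n}) (be be' : 'I_n -> nat) : no_relation mu S ->
  \prod_(j in S) mu j ^+ be j = \prod_(j in S) mu j ^+ be' j ->
  forall j, j \in S -> be j = be' j.
Proof.
move=> nr e; pose A := [set j in S | (be' j <= be j)%N]%SET.
pose x j := (if j \in A then be j - be' j else be' j - be j)%N.
have splitS (F : 'I_n -> C) : \prod_(j in S) F j = \prod_(j in A) F j * \prod_(j in S :\: A) F j.
  have sub : (A \subset S)%SET by apply/fintype.subsetP => j; rewrite inE => /andP[].
  by rewrite (big_setID A) /= (finset.setIidPr sub).
have e' : \prod_(j in A) mu j ^+ x j = \prod_(j in (S :\: A)%SET) mu j ^+ x j.
  have hmin : \prod_(j in S) mu j ^+ minn (be j) (be' j) != 0.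
    by apply/prodf_neq0 => j _; rewrite expf_neq0.
  apply: (mulfI hmin).
  transitivity (\prod_(j in S) mu j ^+ be j).
    rewrite !splitS -mulrA [_ * \prod_(j in A) _]mulrC mulrA -big_split /=; congr (_ * _).
      apply: eq_bigr => j jA; rewrite -exprD /x jA; congr (_ ^+ _).
      by move: jA; rewrite inE => /andP[_ h]; rewrite (minn_idPr h) subnKC.
    apply: eq_bigr => j; rewrite !inE => /andP[h1 h2]; congr (_ ^+ _).
    by move: h1; rewrite h2 /= -ltnNge => /ltnW/minn_idPl.
  rewrite e !splitS -mulrA -big_split /=; congr (_ * _).
    apply: eq_bigr => j; rewrite inE => /andP[_ h]; congr (_ ^+ _).
    by rewrite (minn_idPr h).
  apply: eq_bigr => j; rewrite !inE => /andP[h1 h2]; rewrite -exprD /x inE h2 /=.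
  move: h1; rewrite h2 /= -ltnNge => h1; congr (_ ^+ _).
  by rewrite leqNgt h1 /= (minn_idPl (ltnW h1)) subnKC // ltnW.
have AB : (A :&: (S :\: A) = finset.set0)%SET.
  by apply/finset.setP => j; rewrite !inE; case: (j \in S); case: (_ <= _)%N.
have AuB : (A :|: (S :\: A) = S)%SET.
  by apply/finset.setP => j; rewrite !inE; case: (j \in S); case: (_ <= _)%N.
move=> j jS; have := nr A _ x AB AuB e' j jS; rewrite /x inE jS /=.
by case: leqP => h; lia.
Qed.

Section Codom.
Variables (k : nat) (i : {ffun 'I_k -> 'I_n}).
Hypothesis ii : increasing i.

Lemma codom_big (T : Type) (idx : T) (op : Monoid.com_law idx) (F : 'I_n -> T) :
  \big[op/idx]_(a < k) F (i a) = \big[op/idx]_(j in codom i) F j.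
Proof.
have u : uniq (codom i) by rewrite map_inj_uniq ?enum_uniq //; exact: increasing_inj.
by rewrite -(big_uniq _ u) /= big_image.
Qed.

Lemma prod_codom : \prod_a mu (i a) = \prod_j mu j ^+ (j \in codom i).
Proof.
rewrite (codom_big _ mu) big_mkcond; apply: eq_bigr => j _.
by case: (_ \in _).
Qed.

Lemma sum_codom (P : pred 'I_n) :
  \sum_(j | P j) (j \in codom i : nat) = #|[set a : 'I_k | P (i a)]%SET|.
Proof.
rewrite -sum1dep_card [RHS]big_mkcond /= (codom_big _ (fun j => if P j then 1%N else 0%N)).
rewrite [LHS]big_mkcond [RHS]big_mkcond /=.
by apply: eq_bigr => j _; case: (P j); case: (j \in codom i).
Qed.

End Codom.

(** Monomials are regrouped by their exponents in the variables selected by [iota], with [A] the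
    common factor of the rest. The degree condition bounds those exponents by [m], so [inord] loses
    nothing where the coefficient is nonzero. *)
Lemma mono_sum_homogeneous (D p m s : nat) (iota : 'I_p -> 'I_n) (c : {ffun 'I_n -> 'I_D} -> C)
    (A : 'rV[C]_n -> C) :
  (forall al, c al != 0 -> (\sum_l al (iota l) + s)%N = m /\
     forall z, mono z al = A z * \prod_l z 0 (iota l) ^+ al (iota l)) ->
  exists c' : {ffun 'I_p -> 'I_m.+1} -> C, forall z,
    \sum_al c al * mono z al = A z * homogeneous_sum s c' (fun l => z 0 (iota l)).
Proof.
move=> hc; pose F (al : {ffun 'I_n -> 'I_D}) : {ffun 'I_p -> 'I_m.+1} :=
  [ffun l => inord (al (iota l))].
have FE al l : c al != 0 -> F al l = al (iota l) :> nat.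
  move=> /hc [em _]; rewrite ffunE inordK // ltnS -em (bigD1 l) //= -addnA; exact: leq_addr.
exists (fun be => \sum_(al | (c al != 0) && (F al == be)) c al) => z.
rewrite (bigID (fun al => c al != 0)) /= [X in _ + X]big1 ?addr0; last first.
  by move=> al; rewrite negbK => /eqP ->; rewrite mul0r.
rewrite (partition_big F (fun be => (\sum_(l < p) be l + s)%N == m)) /=; last first.
  move=> al cal; apply/eqP; rewrite -[RHS](hc al cal).1; congr (_ + _)%N.
  by apply: eq_bigr => l _; rewrite FE.
rewrite /homogeneous_sum mulr_sumr; apply: eq_bigr => be _.
rewrite mulrCA mulr_suml; apply: eq_bigr => al /andP[cal /eqP Fal].
rewrite (hc al cal).2; congr (_ * (_ * _)).
by apply: eq_bigr => l _; rewrite -Fal FE.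
Qed.

End Exponents.

(** * The coefficients of a Pfaff system *)

Section PfaffSystem.
Variables (R : realType) (n : nat) (mu : 'I_n -> Cplx R).
Local Notation C := (Cplx R).
Hypothesis n2 : (2 <= n)%N.
Hypothesis hmu : forall i, 0 < `|mu i| /\ `|mu i| < 1.
Variables (b : C) (k : nat) (omega : hopf_frames mu k -> hopf_line_bundle mu b).
Hypothesis hb : b != 0.
Hypothesis homega : pfaff_system omega.
Variable theta : 'rV[C]_n -> 'M[C]_(k, n) -> C.
Hypothesis hth : is_pullback omega theta.
Hypothesis hol : holomorphic_form theta.

Let mu_n0 i : mu i != 0 := mu_neq0 hmu i.

(* The degree bound comes from the growth of each component, hence depends on it. *)
Definition coef_family := {D : nat & {ffun 'I_n -> 'I_D} -> C}.
Definition coef_sum (c : coef_family) (z : 'rV[C]_n) : C :=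
  \sum_al projT2 c al * mono z al.

Lemma component_expansion (i : {ffun 'I_k -> 'I_n}) : increasing i ->
  exists c : coef_family,
    (forall z, z != 0 -> theta z (basis_frame R i) = coef_sum c z) /\
    (forall al, projT2 c al != 0 ->
       \prod_j mu j ^+ (al j + (j \in codom i)) = b).
Proof.
move=> ii; pose mI := \prod_a mu (i a).
have mI0 : mI != 0 by apply/prodf_neq0 => a _.
have [D [c [h1 h2]]] : exists D (c : {ffun 'I_n -> 'I_D} -> C),
    (forall z, z != 0 -> theta z (basis_frame R i) = \sum_al c al * mono z al) /\
    (forall al, c al != 0 -> \prod_j mu j ^+ al j = b / mI).
  apply: (@eigen_expansion R n mu (fun z => theta z (basis_frame R i)) _ n2 hmu).
  - by rewrite mulf_neq0 // invr_neq0.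
  - by move=> z z0; exact: (hol z0).2.
  - move=> z z0; have fz0 : hopf_map mu z != 0.
      by have := iter_hopf_neq0 hmu 1 z; rewrite /= z0.
    apply: (mulfI mI0); rewrite mulrA mulrCA divff // mulr1.
    rewrite -(pullback_equivariant hmu hb hth _ z0).
    (* On a basis frame df only scales row a by [mu (i a)], so its effect on the value is the factor
       [mI]. *)
    have := form_scale (\row_a mu (i a)) (basis_frame R i) (hol fz0).1.
    under eq_bigr do rewrite mxE.
    rewrite -/mI => <-; congr (theta _ _).
    apply/matrixP => a j; rewrite mul_diag_mx mul_mx_diag !mxE.
    by case: eqP => [->|_]; rewrite ?mulr1 ?mul1r ?mulr0 ?mul0r.
exists (existT _ D c); split => //= al cal.
under eq_bigr do rewrite exprD.
by rewrite big_split /= h2 // -prod_codom // -/mI divfK.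
Qed.

Variable c : {ffun 'I_k -> 'I_n} -> coef_family.
Hypothesis hc : forall i, increasing i ->
  (forall z, z != 0 -> theta z (basis_frame R i) = coef_sum (c i) z) /\
  (forall al, projT2 (c i) al != 0 -> \prod_j mu j ^+ (al j + (j \in codom i)) = b).

Lemma theta_coef z V : z != 0 ->
  theta z V = \sum_(i | increasing i) coef_sum (c i) z * wedge_dz i V.
Proof.
move=> z0; rewrite (form_expansion (hol z0).1); apply: eq_bigr => i ii.
by rewrite (hc ii).1.
Qed.

(** Supplies the reference monomial from which the exponents are read in all three cases. *)
Lemma nonzero_coef : exists i al, increasing i /\ projT2 (c i) al != 0.
Proof.
apply: contrapT => no; have [_ _ [x nx] _] := homega; apply: nx => z hz V _.
rewrite (hth hz V); apply/orb_eqP; congr (zorbit _ (_, _)).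
rewrite theta_coef // big1 // => i ii; rewrite /coef_sum big1 ?mul0r // => al _.
have [->|cal] := eqVneq (projT2 (c i) al) 0; first by rewrite mul0r.
by case: no; exists i, al.
Qed.

Lemma open_neq0 : open [set x : C | x != 0]%classic.
Proof. by rewrite openE => x /= x0; exact: near_neq. Qed.

Lemma upd_continuous (j : 'I_n) (t : C) : continuous (fun z : 'rV[C]_n => upd z j t).
Proof.
move=> z; apply: differentiable_continuous.
rewrite (_ : (fun z => _) = (fun z : 'rV[C]_n => z + (t - z 0 j) *: (delta_mx 0 j : 'rV[C]_n))).
  apply: differentiableD; first exact: ex_diff.
  apply: differentiableZl; apply: differentiableB; first exact: differentiable_cst.
  exact: differentiable_coord.
apply/funext => w; apply/rowP => i; rewrite !mxE; case: eqVneq => [->|_] /=.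
  by rewrite mulr1 addrC subrK.
by rewrite mulr0 addr0.
Qed.

(* Otherwise every component of [theta] is divisible by [z_j], and [Sing] is
   the hypersurface [z_j = 0] near a generic point of it. *)
Lemma exponent_le1 (j : 'I_n) (e : nat) :
  (forall i al, increasing i -> projT2 (c i) al != 0 -> (al j + (j \in codom i))%N = e) ->
  (e <= 1)%N.
Proof.
move=> he; rewrite leqNgt; apply/negP => e2.
have [i0 [al0 [ii0 cn]]] := nonzero_coef.
have factor i (z : 'rV[C]_n) : increasing i ->
    coef_sum (c i) z = z 0 j ^+ (e - (j \in codom i)) * coef_sum (c i) (upd z j 1).
  move=> ii; rewrite /coef_sum mulr_sumr; apply: eq_bigr => al _.
  have [->|cal] := eqVneq (projT2 (c i) al) 0; first by rewrite !mul0r mulr0.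
  rewrite -{1}(upd_same z j) !mono_upd expr1n mul1r -(he i al ii cal) addnK.
  by rewrite mulrCA.
(* Since e >= 2, a factor z_j remains even when dz_j takes up one unit of the weight. *)
have expo (i : {ffun 'I_k -> 'I_n}) : (0 < e - (j \in codom i))%N by case: (j \in codom i); lia.
have van (z : 'rV[C]_n) V : z != 0 -> z 0 j = 0 -> theta z V = 0.
  move=> z0 zj; rewrite theta_coef // big1 // => i ii.
  by rewrite factor // zj expr0n eqn0Ngt expo !mul0r.
have [a ha] : exists a : {ffun 'I_n -> 'I_(projT1 (c i0))}, coef_sum (c i0) (grid C a) != 0.
  apply: contrapT => no; move/eqP: cn; apply.
  rewrite -(grid_coef_mono (projT2 (c i0))) /grid_coef big1 // => a _.
  suff -> : \sum_be projT2 (c i0) be * mono (grid C a) be = 0 by rewrite mul0r.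
  by apply: contrapT => /eqP h; apply: no; exists a.
have [i1 i1j] : exists i1 : 'I_n, i1 != j.
  pose j0 := Ordinal (ltnW n2); pose j1 := Ordinal n2.
  by have [<-|?] := eqVneq j0 j; [exists j1 | exists j0].
(* The cofactor of the power of z_j in component [i0]. It does not involve z_j, and reading it at
   z_j = 1, hence off the origin, makes it continuous everywhere. *)
pose G (z : 'rV[C]_n) := theta (upd z j 1) (basis_frame R i0).
have upd0 (z : 'rV[C]_n) : upd z j 1 != 0.
  by apply/row_neq0P; exists j; rewrite mxE eqxx oner_neq0.
have GE z : G z = coef_sum (c i0) (upd z j 1) by rewrite /G (hc ii0).1.
have cG : continuous G.
  move=> z; apply: (@continuous_comp _ _ C (fun z => upd z j 1)
    (fun z => theta z (basis_frame R i0))); first exact: upd_continuous.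
  by apply: differentiable_continuous; exact: (hol (upd0 z)).2.
(* The first condition keeps [U] in W; by the second, component [i0] vanishes on [U] only where z_j
   = 0. The point [p] below is a grid point where that component is nonzero, projected to z_j =
   0. *)
pose U := [set z : 'rV[C]_n | z 0 i1 != 0 /\ G z != 0]%classic.
pose h := (mulmxr (delta_mx j 0 : 'M[C]_(n, 1)) : 'rV[C]_n -> 'rV[C]_1).
have hE z : h z = 0 <-> z 0 j = 0.
  have e1 : h z 0 0 = z 0 j.
    rewrite /h /= mxE (bigD1 j) //= big1 ?addr0 ?mxE ?eqxx ?mulr1 // => x xj.
    by rewrite mxE (negPf xj) mulr0.
  split=> [h0|zj]; first by rewrite -e1 h0 mxE.
  by apply/rowP => x; rewrite ord1 e1 zj mxE.
pose p := upd (grid C a) j 0.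
have pi1 : p 0 i1 != 0 by rewrite !mxE (negPf i1j) node_neq0.
have U_neq0 z : U z -> z != 0 by move=> [zi _]; apply/row_neq0P; exists i1.
have Up : U p.
  split => //; rewrite GE.
  have -> : upd p j 1 = upd (grid C a) j 1.
    by apply/rowP => x; rewrite !mxE; case: eqP.
  by apply: contraNneq ha => h0; rewrite factor // h0 mulr0.
have [_ _ _ codim2] := homega.
set Z := (X in analytic_codim_ge X) in codim2.
have ZP (z : 'rV[C]_n) : z != 0 -> z 0 j = 0 -> Z z.
  move=> z0 zj; exists z0 => z' hz' V eo.
  have zj' : z' 0 j = 0.
    have [m [e'|e']] := orb_eq_iter eo.
      by rewrite -e' iter_hopf zj mulr0.
    apply/eqP; rewrite -(mulrI_eq0 (z' 0 j) (mulfI (expf_neq0 m (mu_n0 j)))).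
    by rewrite -iter_hopf e' zj.
  by rewrite (hth hz' V); apply/orb_eqP; congr (zorbit _ (_, _)); exact: van.
have : (2 <= 1)%N; last by [].
apply: (codim2 p 1%N); first by apply: ZP; [exact: U_neq0 | rewrite mxE eqxx].
exists U, h; split => //.
- rewrite (_ : U = (fun z : 'rV[C]_n => z 0 i1) @^-1` [set x : C | x != 0] `&`
                   G @^-1` [set x : C | x != 0])%classic //.
  by apply: openI; apply: open_comp; try exact: open_neq0; move=> z _;
    [exact: coord_continuous | exact: cG].
- move=> z _; split; first exact: mulmxr_differentiable.
  rewrite /jacobian diff_mulmxr (_ : lin1_mx _ = delta_mx j 0) ?mxrank_delta //.
  by apply/matrixP => x y; rewrite mxE /= -rowE mxE.
- apply/seteqP; split => z.
    move=> [[z0 sz] Uz]; split => //; apply/hE.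
    have th0 : theta z (basis_frame R i0) = 0.
      have eo := sz z z0 (basis_frame R i0) erefl; rewrite (hth z0) in eo.
      exact: (orb_line_inj hmu eo).
    move: th0; rewrite (hc ii0).1 // factor // -GE => /eqP.
    rewrite mulf_eq0 (negPf Uz.2) orbF expf_eq0 expo /= => /eqP //.
  by move=> [Uz /hE zj]; split => //; apply: ZP => //; exact: U_neq0.
Qed.

Lemma coef_sum_factor i (A : 'rV[C]_n -> C) : (forall al, projT2 (c i) al != 0 ->
    forall z, mono z al = A z) ->
  forall z, coef_sum (c i) z = (\sum_al projT2 (c i) al) * A z.
Proof.
move=> h z; rewrite /coef_sum mulr_suml; apply: eq_bigr => al _.
have [->|cal] := eqVneq (projT2 (c i) al) 0; first by rewrite !mul0r.
by rewrite h.
Qed.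

Lemma classical_case (mu0 : C) : classical mu mu0 ->
  exists m : nat,
    [/\ (k <= m)%N, b = mu0 ^+ m
      & exists d : {ffun 'I_k -> 'I_n} -> {ffun 'I_n -> 'I_m.+1} -> C,
          forall (z : 'rV[C]_n) (V : 'M[C]_(k, n)), z != 0 ->
            theta z V = \sum_(i : {ffun 'I_k -> 'I_n} | increasing i)
              homogeneous_sum k (d i) (fun l => z 0 l) * wedge_dz i V].
Proof.
move=> cl; have [i0 [al0 [ii0 cn0]]] := nonzero_coef.
have deg i (al : {ffun 'I_n -> 'I_(projT1 (c i))}) : increasing i -> projT2 (c i) al != 0 ->
    mu0 ^+ (\sum_j al j + k) = b.
  move=> ii cal; rewrite -((hc ii).2 al cal).
  rewrite (eq_bigr (fun j => mu0 ^+ (al j + (j \in codom i)))); last by move=> j _; rewrite cl.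
  rewrite -expr_sum big_split /=; congr (_ ^+ (_ + _)).
  by rewrite (sum_codom ii predT) -[LHS]card_ord; apply: eq_card => x; rewrite !inE.
pose m := (\sum_j al0 j + k)%N.
have degm i al : increasing i -> projT2 (c i) al != 0 -> (\sum_j al j + k)%N = m.
  move=> ii cal; have := deg i al ii cal; rewrite -(deg i0 al0 ii0 cn0).
  (* 0 < |mu0| < 1, so a power of [mu0] determines its exponent. *)
  have := cmod_mu hmu (Ordinal (ltnW n2)); rewrite cl => /andP[m0 m1] /(congr1 (@cmod R)).
  rewrite !cmodX => /eqP; rewrite eq_le !ler_iXn2l // => /eqP; rewrite -/m; lia.
exists m; split; [exact: leq_addl | by rewrite -(deg i0 al0 ii0 cn0) | ].
have /fin_all_exists [d hd] : forall i : {ffun 'I_k -> 'I_n},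
    exists d : {ffun 'I_n -> 'I_m.+1} -> C, increasing i ->
    forall z, coef_sum (c i) z = homogeneous_sum k d (fun l => z 0 l).
  move=> i; have [ii|nii] := boolP (increasing i); last by exists (fun=> 0).
  have [al cal|d hd] := @mono_sum_homogeneous R n (projT1 (c i)) n m k id (projT2 (c i)) (fun=> 1).
    by split; [exact: degm | move=> z; rewrite mul1r].
  by exists d => _ z; rewrite /coef_sum hd mul1r.
exists d => z V z0; rewrite theta_coef //; apply: eq_bigr => i ii.
by rewrite hd.
Qed.

Lemma no_resonance_case : no_resonance mu ->
  exists m : 'I_n -> nat,
    [/\ forall j, m j = 0%N \/ m j = 1%N,
        b = \prod_(j < n) mu j ^+ m j
      & exists d : {ffun 'I_k -> 'I_n} -> C,
          forall (z : 'rV[C]_n) (V : 'M[C]_(k, n)), z != 0 ->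
            theta z V = \sum_(i : {ffun 'I_k -> 'I_n} | increasing i)
              (d i * \prod_(j < n | j \notin codom i) z 0 j ^+ m j) * wedge_dz i V].
Proof.
move=> [_ nr]; have [i0 [al0 [ii0 cn0]]] := nonzero_coef.
pose m j := (al0 j + (j \in codom i0))%N.
have bm : \prod_j mu j ^+ m j = b by exact: (hc ii0).2.
have prodT (F : 'I_n -> C) : \prod_(j in [set: 'I_n]%SET) F j = \prod_j F j.
  by apply: eq_bigl => j; rewrite inE.
have expo i (al : {ffun 'I_n -> 'I_(projT1 (c i))}) j : increasing i -> projT2 (c i) al != 0 ->
    (al j + (j \in codom i))%N = m j.
  move=> ii cal; apply: (no_relation_unique mu_n0 nr (be := fun j => (al j + (j \in codom i))%N));
    last by rewrite inE.
  by rewrite !prodT bm; exact: (hc ii).2.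
have m1 j : (m j <= 1)%N by apply: (@exponent_le1 j) => i al; exact: expo.
exists m; split => //; first by move=> j; move: (m1 j); case: (m j) => [|[]]; auto.
exists (fun i => \sum_al projT2 (c i) al) => z V z0; rewrite theta_coef //.
apply: eq_bigr => i ii; congr (_ * _).
apply: (@coef_sum_factor i (fun z => \prod_(j < n | j \notin codom i) z 0 j ^+ m j)).
(* If j belongs to I, the bound m j <= 1 forces the exponent of z_j in [al] to be 0; otherwise that
   exponent is m j. *)
move=> al cal w; rewrite /mono big_mkcond /= [RHS]big_mkcond /=; apply: eq_bigr => j _.
have := expo i al j ii cal; have := m1 j.
case: (j \in codom i) => /=; rewrite ?addn0 ?addn1 => h1 h2; last by rewrite h2.
by move: h1; rewrite -h2 ltnS leqn0 => /eqP ->.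
Qed.

Lemma weak_no_resonance_case (r : 'I_n) (mu0 : C) : weak_no_resonance mu r mu0 ->
  exists (m : nat) (e : 'I_n -> nat),
    [/\ forall j : 'I_n, (r <= j)%N -> e j = 0%N \/ e j = 1%N,
        b = mu0 ^+ m * \prod_(j < n | (r <= j)%N) mu j ^+ e j
      & exists d : {ffun 'I_k -> 'I_n} -> {ffun 'I_r -> 'I_m.+1} -> C,
          forall (z : 'rV[C]_n) (V : 'M[C]_(k, n)), z != 0 ->
            theta z V = \sum_(i : {ffun 'I_k -> 'I_n} | increasing i)
              (\prod_(j < n | (r <= j)%N && (j \notin codom i)) z 0 j ^+ e j
               * homogeneous_sum #|[set a : 'I_k | (i a < r)%N]%SET| (d i)
                   (fun l => z 0 (widen_ord (ltnW (ltn_ord r)) l)))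
              * wedge_dz i V].
Proof.
move=> [r2 mur nr]; have [i0 [al0 [ii0 cn0]]] := nonzero_coef.
pose w (l : 'I_r) : 'I_n := widen_ord (ltnW (ltn_ord r)) l.
pose deg (be : 'I_n -> nat) := (\sum_(j < n | (j < r)%N) be j)%N.
have prodE (be : 'I_n -> nat) : \prod_j mu j ^+ be j =
    mu0 ^+ deg be * \prod_(j < n | (r <= j)%N) mu j ^+ be j.
  rewrite (bigID (fun j : 'I_n => (j < r)%N)) /=; congr (_ * _).
    rewrite /deg expr_sum; apply: eq_bigr => j jr; by rewrite mur.
  by apply: eq_bigl => j; rewrite -leqNgt.
pose S := [set i : 'I_n | (i == 0 :> nat) || (r <= i)%N]%SET.
pose j0 : 'I_n := Ordinal (ltnW n2).
have r0 : (0 < r)%N by exact: ltnW.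
(* As the first [r] multipliers coincide, only their total exponent can be determined; it is placed
   at index 0, the representative of this group in [S]. *)
pose ga (be : 'I_n -> nat) j := if j == j0 then deg be else be j.
have prodS be : \prod_(j in S) mu j ^+ ga be j = \prod_j mu j ^+ be j.
  have j0S : j0 \in S by rewrite inE eqxx.
  rewrite prodE (bigD1 j0) //= /ga eqxx mur //; congr (_ * _).
  apply: eq_big => [j|j /andP[_ /negPf ->] //].
  rewrite inE -val_eqE /=; case: (eqVneq (val j) 0%N) => [->|] /=; last by rewrite andbT.
  by rewrite leqNgt r0.
pose be0 j := (al0 j + (j \in codom i0))%N.
have expo i (al : {ffun 'I_n -> 'I_(projT1 (c i))}) j : increasing i -> projT2 (c i) al != 0 ->
    j \in S -> ga (fun j => (al j + (j \in codom i))%N) j = ga be0 j.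
  move=> ii cal; apply: (no_relation_unique mu_n0 nr).
  by rewrite !prodS (hc ii).2 // (hc ii0).2.
have j0S : j0 \in S by rewrite inE eqxx.
have high (j : 'I_n) : (r <= j)%N -> (j \in S) /\ (j == j0) = false.
  move=> rj; split; first by rewrite inE rj orbT.
  by apply/negP => /eqP ej; move: rj; rewrite ej leqNgt r0.
have expoh i (al : {ffun 'I_n -> 'I_(projT1 (c i))}) (j : 'I_n) :
    increasing i -> projT2 (c i) al != 0 -> (r <= j)%N ->
    (al j + (j \in codom i))%N = be0 j.
  by move=> ii cal /high [jS nj]; have := expo i al j ii cal jS; rewrite /ga nj.
have e1 (j : 'I_n) : (r <= j)%N -> (be0 j <= 1)%N.
  by move=> rj; apply: (@exponent_le1 j) => i al ii cal; exact: expoh.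
pose m := deg be0.
exists m, be0; split.
- by move=> j /e1; case: (be0 j) => [|[]]; auto.
- by rewrite -prodE (hc ii0).2.
have /fin_all_exists [d hd] : forall i : {ffun 'I_k -> 'I_n},
    exists d : {ffun 'I_r -> 'I_m.+1} -> C, increasing i -> forall z, coef_sum (c i) z =
      \prod_(j < n | (r <= j)%N && (j \notin codom i)) z 0 j ^+ be0 j
      * homogeneous_sum #|[set a : 'I_k | (i a < r)%N]%SET| d (fun l => z 0 (w l)).
  move=> i; have [ii|nii] := boolP (increasing i); last by exists (fun=> 0).
  have [al cal|d hd] := @mono_sum_homogeneous R n (projT1 (c i)) r m
    #|[set a : 'I_k | (i a < r)%N]%SET|
    w (projT2 (c i)) (fun z => \prod_(j < n | (r <= j)%N && (j \notin codom i)) z 0 j ^+ be0 j);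
    last by exists d => _ z; exact: hd.
  split.
    (* At index 0 the determined number is the degree of [al] in the first [r] variables plus the
       number s of the i_a below [r]. *)
    have := expo i al j0 ii cal j0S; rewrite /ga eqxx -/m => <-.
    rewrite /deg big_split /= (sum_codom ii (fun j => j < r)%N); congr (_ + _)%N.
    by rewrite (big_ord_narrow (ltnW (ltn_ord r))).
  move=> z; rewrite /mono (bigID (fun j : 'I_n => (r <= j)%N)) /=; congr (_ * _).
    rewrite [LHS]big_mkcond [RHS]big_mkcond /=; apply: eq_bigr => j _.
    case: (boolP (r <= j)%N) => //= rj; have := expoh i al j ii cal rj; have := e1 j rj.
    case: (j \in codom i) => /=; rewrite ?addn0 ?addn1 => h1 h2; last by rewrite h2.
    by move: h1; rewrite -h2 ltnS leqn0 => /eqP ->.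
  rewrite (eq_bigl (fun j : 'I_n => (j < r)%N)); last by move=> j; rewrite -ltnNge.
  by rewrite (big_ord_narrow (ltnW (ltn_ord r))).
exists d => z V z0; rewrite theta_coef //; apply: eq_bigr => i ii.
by rewrite hd.
Qed.

End PfaffSystem.

Theorem theorem1p3 (R : realType) (n : nat) (hn : (2 <= n)%N)
    (mu : 'I_n -> Cplx R) (hmu : forall i, 0 < `|mu i| /\ `|mu i| < 1)
    (b : Cplx R) (hb : b != 0) (k : nat)
    (omega : hopf_frames mu k -> hopf_line_bundle mu b)
    (homega : pfaff_system omega)
    (theta : 'rV[Cplx R]_n -> 'M[Cplx R]_(k, n) -> Cplx R)
    (htheta : is_pullback omega theta) :
  (forall mu0 : Cplx R, classical mu mu0 ->
     exists m : nat,
       [/\ (k <= m)%N, b = mu0 ^+ m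
         & exists c : {ffun 'I_k -> 'I_n} -> {ffun 'I_n -> 'I_m.+1} -> Cplx R,
             forall (z : 'rV[Cplx R]_n) (V : 'M[Cplx R]_(k, n)), z != 0 ->
               theta z V =
               \sum_(i : {ffun 'I_k -> 'I_n} | increasing i)
                 homogeneous_sum k (c i) (fun l => z 0 l) * wedge_dz i V])
  /\
  (no_resonance mu ->
     exists m : 'I_n -> nat,
       [/\ forall j, m j = 0%N \/ m j = 1%N,
           b = \prod_(j < n) mu j ^+ m j
         & exists c : {ffun 'I_k -> 'I_n} -> Cplx R,
             forall (z : 'rV[Cplx R]_n) (V : 'M[Cplx R]_(k, n)), z != 0 ->
               theta z V =
               \sum_(i : {ffun 'I_k -> 'I_n} | increasing i)
                 (c i * \prod_(j < n | j \notin codom i) z 0 j ^+ m j)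
                 * wedge_dz i V])
  /\
  (forall (r : 'I_n) (mu0 : Cplx R), weak_no_resonance mu r mu0 ->
     exists (m : nat) (e : 'I_n -> nat),
       [/\ forall j : 'I_n, (r <= j)%N -> e j = 0%N \/ e j = 1%N,
           b = mu0 ^+ m * \prod_(j < n | (r <= j)%N) mu j ^+ e j
         & exists c : {ffun 'I_k -> 'I_n} -> {ffun 'I_r -> 'I_m.+1} -> Cplx R,
             forall (z : 'rV[Cplx R]_n) (V : 'M[Cplx R]_(k, n)), z != 0 ->
               theta z V =
               \sum_(i : {ffun 'I_k -> 'I_n} | increasing i)
                 (\prod_(j < n | (r <= j)%N && (j \notin codom i)) z 0 j ^+ e j
                  * homogeneous_sum #|[set a : 'I_k | (i a < r)%N]| (c i)
                      (fun l => z 0 (widen_ord (ltnW (ltn_ord r)) l)))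
                 * wedge_dz i V]).
Proof.
have [_ [th hth hol] _ _] := homega.
(* [theta] is any pullback; holomorphy is known for the one contained in [homega], and the two agree
   on W. *)
have thE (z : 'rV[Cplx R]_n) (V : 'M[Cplx R]_(k, n)) : z != 0 -> theta z V = th z V.
  exact: (pullback_unique hmu htheta hth).
have /fin_all_exists [c hc] : forall i : {ffun 'I_k -> 'I_n}, exists c : coef_family R n,
    increasing i ->
    (forall z, z != 0 -> th z (basis_frame R i) = coef_sum c z) /\
    (forall al, projT2 c al != 0 -> \prod_j mu j ^+ (al j + (j \in codom i)) = b).
  move=> i; have [ii|_] := boolP (increasing i).
    by have [c hc] := component_expansion hn hmu hb hth hol ii; exists c.
  (* Default value at tuples that are not increasing, which the sums skip. *)
  by exists (existT _ 0%N (fun=> 0)).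
split; [move=> mu0 cl | split; [move=> nr | move=> r mu0 wnr]].
- have [m [km bm [d hd]]] := classical_case hn hmu hb homega hth hol hc cl.
  by exists m; split => //; exists d => z V z0; rewrite thE // hd.
- have [m [m01 bm [d hd]]] := no_resonance_case hn hmu hb homega hth hol hc nr.
  by exists m; split => //; exists d => z V z0; rewrite thE // hd.
- have [m [e [e01 bm [d hd]]]] := weak_no_resonance_case hn hmu hb homega hth hol hc wnr.
  by exists m, e; split => //; exists d => z V z0; rewrite thE // hd.
Qed.
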